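(* Let $(Z,d_Z)$ be a complete separable metric space and $p\in[1,\infty]$. If $(Z,d_Z)$ is geodesic, then the metric space $(\mathcal{M}_\sim^{Z,p},\mathrm{GW}_p^Z)$ is geodesic.
   Context: A metric space $(S,d_S)$ is geodesic if for all $x,x'\in S$ there is a path $\gamma:[0,1]\to S$ with $\gamma(0)=x$, $\gamma(1)=x'$ and $d_S(\gamma(s),\gamma(t))=|t-s|\,d_S(x,x')$ for all $s,t\in[0,1]$. A $(Z,p)$-network is a triple $(X,\omega_X,\mu_X)$ where $X$ is a Polish space, $\mu_X$ is a Borel probability measure on $X$, and $\omega_X:X\times X\to Z$ is measurable with $\|d_Z(\omega_X(\cdot,\cdot),z_0)\|_{L^p(\mu_X\otimes\mu_X)}<\infty$ for some (equivalently every) $z_0\in Z$. $\mathcal{C}(\mu_X,\mu_Y)$ is the set of probability measures on $X\times Y$ with marginals $\mu_X$ and $\mu_Y$. Define $$\mathrm{GW}_p^Z(X,Y)=\tfrac12\inf_{\pi\in\mathcal{C}(\mu_X,\mu_Y)}\big\|(x,y,x',y')\mapsto d_Z(\omega_X(x,x'),\omega_Y(y,y'))\big\|_{L^p(\pi\otimes\pi)}$$ (essential supremum if $p=\infty$). $(Z,p)$-networks $X$ and $Y$ are weakly isomorphic, $X\sim Y$, if there exist a $(Z,p)$-network $(W,\omega_W,\mu_W)$ and measurable maps $\phi_X:W\to X$, $\phi_Y:W\to Y$ with $(\phi_X)_*\mu_W=\mu_X$, $(\phi_Y)_*\mu_W=\mu_Y$ and $\omega_W(w,w')=\omega_X(\phi_X(w),\phi_X(w'))=\omega_Y(\phi_Y(w),\phi_Y(w'))$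 for $\mu_W\otimes\mu_W$-almost every $(w,w')$. $\mathcal{M}_\sim^{Z,p}$ is the quotient of the collection of all $(Z,p)$-networks by $\sim$; $\mathrm{GW}_p^Z$ is a metric on it. *)

(* Defs.v *)
From HB Require Import structures.
From mathcomp Require Import all_boot all_order all_algebra.
From mathcomp Require Import all_classical all_reals all_analysis.

Set Implicit Arguments.
Unset Strict Implicit.
Unset Printing Implicit Defensive.

Import Order.TTheory GRing.Theory Num.Theory.
Import numFieldTopology.Exports.

Local Open Scope classical_set_scope.
Local Open Scope ring_scope.
Local Open Scope ereal_scope.

(* The distance takes values in \bar R so that this applies both to a metric
   space, through x y |-> (mdist x y)%:E, and to the Gromov-Wasserstein
   distance, an infimum in \bar R. The path is only constrained on [0, 1]. *)
Definition geodesic (R : realType) (S : Type) (d : S -> S -> \bar R) : Prop :=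
  forall x x' : S, exists gamma : R -> S,
    [/\ gamma 0%R = x, gamma 1%R = x' &
        forall s t : R, (0 <= s <= 1)%R -> (0 <= t <= 1)%R ->
          d (gamma s) (gamma t) = `|t - s|%:E * d x x'].

(* The library's completeness, without its requirement of a base point. *)
Definition complete_space (T : uniformType) : Prop :=
  forall F : set_system T, ProperFilter F -> cauchy F -> exists z : T, F --> z.

Definition separable_space (T : topologicalType) : Prop :=
  exists2 D : set T, countable D & dense D.

(* Homeomorphic to a complete separable metric space. *)
Definition polish (R : realType) (X : topologicalType) : Prop :=
  exists (M : metricType R) (f : X -> M) (g : M -> X),
    [/\ complete_space M, separable_space M,
        cancel f g /\ cancel g f, continuous f & continuous g].

Definition borel (X : ptopologicalType) := g_sigma_algebraType (@open X).

(* [measurable_fun setT f] for the Borel sigma-algebra of Z, written out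
   because a measurableType is pointed whereas Z may be empty. *)
Definition borel_measurable d (T : measurableType d) (Z : topologicalType)
    (f : T -> Z) : Prop :=
  forall A : set Z, <<s @open Z >> A -> measurable (f @^-1` A).

(* Two measures are compared on measurable sets only: a measure is a function
   on all sets, with unspecified values outside the sigma-algebra. *)
Definition is_pushforward (R : realType) d1 d2 (T1 : measurableType d1)
    (T2 : measurableType d2) (f : T1 -> T2)
    (mu : probability T1 R) (nu : probability T2 R) : Prop :=
  forall A : set T2, measurable A -> pushforward mu f A = nu A.

Section networks.
Variables (R : realType) (Z : metricType R) (p : \bar R).

(* The base point of the carrier is no restriction: a space with a probability
   measure is nonempty. *)
Record network := Network {
  carrier : ptopologicalType ;
  carrier_polish : polish R carrier ;
  nmeas : probability (borel carrier) R ;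
  omega : borel carrier * borel carrier -> Z ;
  omega_measurable : borel_measurable omega ;
  omega_Lp : exists z0 : Z,
    Lnorm (nmeas \x nmeas) p (fun u => (mdist (omega u) z0)%:E) < +oo
}.

Definition coupling (X Y : network) :
    set (probability (borel (carrier X) * borel (carrier Y))%type R) :=
  [set pi | is_pushforward fst pi (nmeas X) /\
            is_pushforward snd pi (nmeas Y)].

(* The variable u ranges over pairs ((x, y), (x', y')). *)
Definition GW (X Y : network) : \bar R :=
  2^-1%:E * ereal_inf
    [set Lnorm (pi \x pi) p
           (fun u => (mdist (omega (u.1.1, u.2.1)) (omega (u.1.2, u.2.2)))%:E)
    | pi in @coupling X Y].

Definition weak_iso (X Y : network) : Prop :=
  exists (W : network) (phiX : borel (carrier W) -> borel (carrier X))
         (phiY : borel (carrier W) -> borel (carrier Y)),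
    [/\ measurable_fun setT phiX, measurable_fun setT phiY,
        is_pushforward phiX (nmeas W) (nmeas X),
        is_pushforward phiY (nmeas W) (nmeas Y) &
        {ae nmeas W \x nmeas W, forall w,
          omega w = omega (phiX w.1, phiX w.2) /\
          omega w = omega (phiY w.1, phiY w.2)}].

(* The equivalence classes. Plain predicates instead of [set network], which is
   ruled out by universe constraints. *)
Definition network_class : Type :=
  {C : network -> Prop | exists X : network, C = weak_iso X}.

Definition class_repr (C : network_class) : network := sval (cid (svalP C)).

(* The choice of representatives is immaterial: GW is invariant under weak
   isomorphism. *)
Definition GW_class (C D : network_class) : \bar R :=
  GW (class_repr C) (class_repr D).

End networks.

(* Main.v *)
Require Import Defs.
From HB Require Import structures.
From mathcomp Require Import all_boot all_order all_algebra.
From mathcomp Require Import all_classical all_reals all_analysis.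
From mathcomp Require Import measurable_realfun ess_sup_inf.
From mathcomp Require Import zify ring lra.

(** Let pi be an optimal coupling of two networks X and Y. On the square of the
    space of pi live the two kernels a = omega_X and b = omega_Y. For each pair of
    points u choose a geodesic of Z from a u to b u, and let h t u be its point at
    time t; the network X_t is the space of pi with the kernel h t. The diagonal
    coupling of X_s and X_t gives
      GW X_s X_t <= |t - s| * GW X Y,
    because the distance from h s u to h t u is |t - s| times the distance from
    a u to b u. This covers the endpoints, X_0 being X itself and X_1 being Y,
    whose kernels are pulled back to a = h 0 and b = h 1. The triangle inequality
    then turns these inequalities into equalities ([network_geodesic]).
    Everything passes to weak isomorphism classes: weakly isomorphic networks are
    at distance 0, so by the triangle inequality replacing a network by a weakly
    isomorphic one changes no distance ([GW_weak_iso_eq]). Three points need an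
    argument.

    - The geodesic has to be chosen measurably in u ([geodesic_selection]). Since
      Z need not be locally compact, neither compactness nor a nearest-point rule
      yields a Borel choice. But geodesics can be coded by sequences of integers
      so that the codes of the geodesics from a u to b u are the branches of a
      tree depending measurably on u, and a branch of such a tree can be chosen
      measurably outside a null set ([souslin_selection]), which is enough for
      kernels.

    - Optimal couplings exist ([optimal_coupling]). As the kernels are merely
      measurable, narrow convergence of couplings would not control them.
      Instead, along an ultrafilter a minimising sequence converges on every
      measurable rectangle A x B. The limit is additive in A and in B and has the
      right marginals; such a bimeasure is a genuine measure, because it is the
      law of a randomised map ([randomisation]). The squares of couplings of mu
      and nu are couplings of the squares of mu and nu, so they converge too on
      all rectangles E x E' with E a measurable set of pairs in X and E' one in Y.
      This makes the distortion lower semicontinuous ([Lnorm_ultralimit]).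

    - The triangle inequality ([GW_triangle]) requires gluing two couplings along
      their common marginal; [randomisation] provides it, a coupling of Y and V
      being the law of (y, Q (y, u)) for an independent uniform variable u.

    The carrier of X_t is the real line with its Borel sets, equipped with the
    uniform law on [0, 1], of which every law on a product of two Polish spaces
    is an image ([uniform_parametrisation]). *)

Set Implicit Arguments.
Unset Strict Implicit.
Unset Printing Implicit Defensive.

Import Order.TTheory GRing.Theory Num.Theory.
Import numFieldNormedType.Exports.

Local Open Scope classical_set_scope.
Local Open Scope ring_scope.
Local Open Scope ereal_scope.

(** * Measurability of sets given by countable formulas *)

Lemma measurable_preimage d d' (T : measurableType d) (S : measurableType d')
    (f : T -> S) (A : set S) :
  measurable_fun setT f -> measurable A -> measurable (f @^-1` A).
Proof. by move=> mf mA; rewrite -[X in measurable X]setTI; exact: mf. Qed.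

Section measurable_formulas.
Context d (T : measurableType d).
Implicit Types P Q : T -> Prop.

Lemma measurable_exists (I : countType) (P : I -> T -> Prop) :
  (forall i, measurable [set u | P i u]) -> measurable [set u | exists i, P i u].
Proof.
move=> mP; have -> : [set u | exists i, P i u] = \bigcup_i [set u | P i u].
  by apply/seteqP; split => u [i]; [exists i | exists i].
by apply: countable_bigcupT_measurable => //; exact: countableP.
Qed.

Lemma measurable_neg P : measurable [set u | P u] -> measurable [set u | ~ P u].
Proof. exact: measurableC. Qed.

Lemma measurable_forall (I : countType) (P : I -> T -> Prop) :
  (forall i, measurable [set u | P i u]) -> measurable [set u | forall i, P i u].
Proof.
move=> mP.
have -> : [set u | forall i, P i u] = ~` [set u | exists i, ~ P i u].
  apply/seteqP; split => [u Pu [i]|u nP i]; first exact.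
  by apply: contrapT => nPu; apply: nP; exists i.
by apply: measurableC; apply: measurable_exists => i; exact: measurable_neg.
Qed.

Lemma measurable_conj P Q : measurable [set u | P u] ->
  measurable [set u | Q u] -> measurable [set u | P u /\ Q u].
Proof. exact: measurableI. Qed.

Lemma measurable_disj P Q : measurable [set u | P u] ->
  measurable [set u | Q u] -> measurable [set u | P u \/ Q u].
Proof. exact: measurableU. Qed.

Lemma measurable_prop (Q : Prop) : measurable [set _ : T | Q].
Proof.
have [q|nq] := pselect Q.
  by have -> : [set _ : T | Q] = setT by apply/seteqP; split.
by have -> : [set _ : T | Q] = set0 by apply/seteqP; split => // u /nq.
Qed.

Lemma measurable_imply (Q : Prop) P :
  (Q -> measurable [set u | P u]) -> measurable [set u | Q -> P u].
Proof.
have [q|nq] := pselect Q => mP.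
  have -> : [set u | Q -> P u] = [set u | P u].
    by apply/seteqP; split => u /=; [apply | move=> Pu _].
  exact: mP.
have -> : [set u | Q -> P u] = setT by apply/seteqP; split => // u _ /nq.
exact: measurableT.
Qed.

End measurable_formulas.

Definition least_nat (Q : nat -> Prop) : nat :=
  if pselect (exists n, `[< Q n >]) is left h then ex_minn h else 0%N.

Lemma least_natP (Q : nat -> Prop) : (exists n, Q n) -> Q (least_nat Q).
Proof.
move=> [n Qn]; rewrite /least_nat; case: pselect => [h|[]].
  by case: ex_minnP => m /asboolP.
by exists n; exact/asboolP.
Qed.

Lemma measurable_least_nat d (T : measurableType d) (Q : nat -> T -> Prop) n :
  (forall i, measurable [set u | Q i u]) ->
  measurable [set u | least_nat (Q^~ u) = n].
Proof.
move=> mQ; have -> : [set u | least_nat (Q^~ u) = n] = [set u |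
    (Q n u /\ (forall j : nat, (j < n)%N -> ~ Q j u))
    \/ ((forall j : nat, ~ Q j u) /\ n = 0%N)].
  apply/seteqP; split => u /=; rewrite /least_nat; case: pselect.
  - move=> h; case: ex_minnP => m /asboolP Qm mmin mn; left; rewrite -mn.
    split => // j jm Qj; have := mmin j; rewrite leqNgt jm => /(_ _)/negP.
    by apply => //; exact/asboolP.
  - move=> nh n0; right; split => // j Qj; apply: nh; exists j.
    exact/asboolP.
  - move=> h; case: ex_minnP => m /asboolP Qm mmin [[Qn nmin]|[nQ _]].
      apply/eqP; rewrite eqn_leq mmin ?andbT; last exact/asboolP.
      by rewrite leqNgt; apply/negP => mn; exact: (nmin m mn).
    by case: (nQ m Qm).
  - move=> nh [[Qn _]|[_ ->]//]; exfalso.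
    by apply: nh; exists n; exact/asboolP.
apply: measurable_disj; apply: measurable_conj.
- exact: mQ.
- apply: measurable_forall => j; apply: measurable_imply => _.
  by apply: measurable_neg; exact: mQ.
- by apply: measurable_forall => j; apply: measurable_neg; exact: mQ.
- exact: measurable_prop.
Qed.

(** * Almost-everywhere uniformisation of a Souslin scheme *)

(** Most recent entry first, so that a prefix is lengthened by a cons and
    shortened by a drop. *)
Fixpoint rpref (E : Type) (a : nat -> E) (n : nat) : seq E :=
  if n is k.+1 then a k :: rpref a k else [::].

Lemma size_rpref (E : Type) (a : nat -> E) n : size (rpref a n) = n.
Proof. by elim: n => //= n ->. Qed.

Lemma drop_rpref (E : Type) (a : nat -> E) k n :
  (k <= n)%N -> drop k (rpref a n) = rpref a (n - k).
Proof.
elim: n k => [|n IH] [|k] kn; rewrite ?drop0 ?subn0// subSS /=.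
exact: IH.
Qed.

Section souslin.
Context d (T : measurableType d) (R : realType) (P : probability T R).
Variable A : seq nat -> set T.
Hypothesis mA : forall s, measurable (A s).

Let branch (a : nat -> nat) (u : T) := forall k, A (rpref a k) u.

Section fixed_level.
Variable c : R.

(** The outer measure of S exceeds c. *)
Let heavy (S : set T) :=
  forall B : set T, measurable B -> S `<=` B -> c%:E < P B.

(** Continuity of the outer measure along increasing unions: if each S j has a
    measurable cover of measure at most c, so has the union, namely the lower
    limit of these covers. *)
Let heavy_bigcup (S : nat -> set T) :
  heavy (\bigcup_j S j) -> {homo S : m n / (m <= n)%N >-> m `<=` n} ->
  exists j, heavy (S j).
Proof.
move=> hS Smono; apply: contrapT => /forallNP nh.
have {}nh j : {B | [/\ measurable B, S j `<=` B & P B <= c%:E]}.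
  apply/cid; have /existsNP[B] := nh j.
  move=> /not_implyP[mB] /not_implyP[SB] /negP; rewrite -leNgt => PB.
  by exists B.
pose B j := sval (nh j).
have BP j : [/\ measurable (B j), S j `<=` B j & P (B j) <= c%:E].
  exact: (svalP (nh j)).
pose H n := \bigcap_(j in [set j | (n <= j)%N]) B j.
have mH n : measurable (H n).
  by apply: bigcap_measurableType => j _; case: (BP j).
have SH : \bigcup_j S j `<=` \bigcup_n H n.
  move=> u [j _ Sju]; exists j => // k /= jk.
  by have [_ SB _] := BP k; apply: SB; exact: (Smono _ _ jk).
have mHU : measurable (\bigcup_n H n) by exact: bigcupT_measurable.
have := hS _ mHU SH; apply/negP; rewrite -leNgt.
have Hhomo : {homo H : n m / (n <= m)%N >-> (n <= m)%O}.
  move=> n m nm; apply/subsetPset => u Hu j /= mj.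
  by apply: Hu => /=; exact: leq_trans mj.
have /cvg_lim <- // := nondecreasing_cvg_mu (mu := P) mH mHU Hhomo.
apply: lime_le.
  by apply/cvg_ex; eexists; exact: (nondecreasing_cvg_mu (mu := P) mH mHU Hhomo).
apply: nearW => n /=.
have [mB _ PB] := BP n; apply: le_trans PB; apply: le_measure; rewrite ?inE//.
by move=> u; apply => /=.
Qed.

Let bounded (s L : seq nat) := all2 leq s L.

(** A projection of a measurable set, not measurable in general, whence the
    outer measure. *)
Let slice (L : seq nat) : set T :=
  [set u | exists2 a, bounded (rpref a (size L)) L & branch a u].

Let slice_cons L : slice L = \bigcup_j slice (j :: L).
Proof.
apply/seteqP; split => [u [a aL au]|u [j _ [a aL au]]].
  by exists (a (size L)) => //; exists a => //; rewrite /bounded /= leqnn.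
by exists a => //; move: aL; rewrite /bounded /= => /andP[].
Qed.

Let slice_heavy_next L : heavy (slice L) -> exists j, heavy (slice (j :: L)).
Proof.
rewrite slice_cons => /heavy_bigcup; apply => m n mn u [a aL au].
exists a => //; move: aL; rewrite /bounded /= => /andP[am ->].
by rewrite (leq_trans am mn).
Qed.

Hypothesis c_lt1 : (c < 1)%R.
Hypothesis branchT : forall u, exists a, branch a u.

Let next (L : seq nat) : nat :=
  if pselect (exists j, heavy (slice (j :: L))) is left h then sval (cid h)
  else 0%N.

Let nextP L : heavy (slice L) -> heavy (slice (next L :: L)).
Proof.
rewrite /next => hL; case: pselect => [h|]; first exact: (svalP (cid h)).
by case/slice_heavy_next: hL => j hj []; exists j.
Qed.

(** The bounds, found one level at a time so that the slices stay heavy. *)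
Let Ls : nat -> seq nat := fix Ls n :=
  if n is k.+1 then next (Ls k) :: Ls k else [::].

Let size_Ls n : size (Ls n) = n.
Proof. by elim: n => //= n ->. Qed.

Let heavy_Ls n : heavy (slice (Ls n)).
Proof.
elim: n => [|n IH]; last exact: nextP.
move=> B mB sB; suff -> : B = setT by rewrite probability_setT lte_fin.
apply/seteqP; split => // u _; apply: sB.
by have [a au] := branchT u; exists a.
Qed.

Let admissible (s : seq nat) (u : T) :=
  bounded s (Ls (size s)) /\
  forall k, (k <= size s)%N -> A (drop k s) u.

Let measurable_admissible s : measurable [set u | admissible s u].
Proof.
apply: measurable_conj; first exact: measurable_prop.
by apply: measurable_forall => k; apply: measurable_imply => _; exact: mA.
Qed.

Let admissible_drop s u n : admissible s u -> (n <= size s)%N ->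
  admissible (drop n s) u.
Proof.
move=> [bs As] ns; split; last first.
  move=> k; rewrite size_drop drop_drop => kn.
  by apply: As; lia.
rewrite size_drop; elim: n ns => [|n IH] ns; first by rewrite drop0 subn0.
have := IH (ltnW ns); rewrite /bounded.
have -> : (size s - n)%N = (size s - n.+1).+1 by lia.
by rewrite (drop_nth 0%N ns) /= => /andP[].
Qed.

(** Equivalent, by Koenig's lemma, to s being a prefix of an infinite branch
    within the bounds; in this form it is visibly measurable in u. *)
Let extends (s : seq nat) (u : T) :=
  forall n, exists s', [/\ size s' = (n + size s)%N, drop n s' = s &
                           admissible s' u].

Let measurable_extends s : measurable [set u | extends s u].
Proof.
apply: measurable_forall => n; apply: measurable_exists => s'.
rewrite (_ : [set _ | _] = [set u | (size s' = (n + size s)%N /\ drop n s' = s)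
  /\ admissible s' u]); last by apply/seteqP; split => [u []|u [[]]].
by apply: measurable_conj => //; exact: measurable_prop.
Qed.

Let extends_admissible s u : extends s u -> admissible s u.
Proof. by move=> /(_ 0%N)[s' [_]]; rewrite drop0 => ->. Qed.

(** Koenig's lemma: were no child of s extendible, each of the finitely many
    children within the bound would fail at some length, and s would have no
    admissible extension longer than the largest of them. *)
Let extends_next s u : extends s u -> exists i, extends (i :: s) u.
Proof.
move=> es; apply: contrapT => /forallNP nex.
have {}nex i : {n | forall s', size s' = (n + (size s).+1)%N ->
    drop n s' = i :: s -> ~ admissible s' u}.
  apply/cid; have /existsNP[n ns'] := nex i; exists n => s' ss' ds' as'.
  by apply: ns'; exists s'.
pose M := \max_(i < (next (Ls (size s))).+1) sval (nex i).
have [s' [ss' ds' as']] := es M.+1.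
have sM : size (drop M s') = (size s).+1 by rewrite size_drop ss'; lia.
have [i di] : exists i, drop M s' = i :: s.
  exists (nth 0%N s' M); rewrite (drop_nth 0%N) ?ss'; last by lia.
  by rewrite -[in RHS]ds'.
have aM : admissible (i :: s) u.
  by rewrite -di; apply: admissible_drop => //; lia.
have iN : (i <= next (Ls (size s)))%N by case: aM => /= /andP[].
have iM : (sval (nex i) <= M)%N.
  have iN' : (i < (next (Ls (size s))).+1)%N by [].
  by have := @leq_bigmax _ (fun i : 'I__ => sval (nex i)) (Ordinal iN').
apply: (svalP (nex i) (drop (M - sval (nex i)) s')).
- by rewrite size_drop ss'; lia.
- by rewrite drop_drop subnKC.
- by apply: admissible_drop => //; lia.
Qed.

(** The next entry of the leftmost branch through s. *)
Let least (s : seq nat) (u : T) : nat := least_nat (fun i => extends (i :: s) u).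

Let measurable_least s i : measurable [set u | least s u = i].
Proof.
apply: (measurable_least_nat (Q := fun i u => extends (i :: s) u)) => j.
exact: measurable_extends.
Qed.

Let st (u : T) : nat -> seq nat := fix st n :=
  if n is k.+1 then least (st k) u :: st k else [::].

Let measurable_st n s : measurable [set u | st u n = s].
Proof.
elim: n s => [|n IH] s; first exact: (measurable_prop _ ([::] = s)).
case: s => [|i s] /=.
  rewrite (_ : [set _ | _] = set0)//; first by apply/seteqP; split.
have -> : [set u | least (st u n) u :: st u n = i :: s] =
    [set u | least s u = i /\ st u n = s].
  by apply/seteqP; split => u /= [<- <-].
by apply: measurable_conj.
Qed.

Let a_ (u : T) (n : nat) := least (st u n) u.

Let measurable_a n i : measurable [set u | a_ u n = i].
Proof.
have -> : [set u | a_ u n = i] =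
    [set u | exists s, st u n = s /\ least s u = i].
  by apply/seteqP; split => u /=; [exists (st u n) | case=> s [<-]].
by apply: measurable_exists => s; exact: measurable_conj.
Qed.

Let a_branch u : extends [::] u -> branch (a_ u) u.
Proof.
move=> e0 k; have -> : rpref (a_ u) k = st u k by elim: k => //= k ->.
have : extends (st u k) u.
  elim: k => //= k /extends_next.
  exact: (least_natP (Q := fun i => extends (i :: _) u)).
by move/extends_admissible => [_ /(_ 0%N)]; rewrite drop0; exact.
Qed.

(** The tree within the bounds has a prefix of length n on a set containing the
    slice at level n, hence of measure above c; let n grow. *)
Let P_extends : c%:E <= P [set u | extends [::] u].
Proof.
pose K n := [set u | exists s', [/\ size s' = (n + 0)%N, drop n s' = [::] &
                           admissible s' u]].
have mK n : measurable (K n).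
  apply: measurable_exists => s'.
  rewrite (_ : [set _ | _] = [set u | (size s' = (n + 0)%N /\
    drop n s' = [::]) /\ admissible s' u]);
    last by apply/seteqP; split => [u []|u [[]]].
  by apply: measurable_conj => //; exact: measurable_prop.
have EK : [set u | extends [::] u] = \bigcap_n K n.
  by apply/seteqP; split => u /= e n => [_|]; exact: e.
have mI : measurable (\bigcap_n K n) by exact: bigcapT_measurable.
have K0 : P (K 0%N) < +oo.
  by rewrite (le_lt_trans (probability_le1 _ _)) ?ltry.
have Kmono : {homo K : n m / (n <= m)%N >-> (m <= n)%O}.
  move=> n m nm; apply/subsetPset => u [s' [ss' _ as']].
  have le1 : (m - n <= size s')%N by rewrite ss'; lia.
  exists (drop (m - n) s'); split; last exact: admissible_drop.
    by rewrite size_drop ss'; lia.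
  by apply: drop_oversize; rewrite size_drop ss'; lia.
rewrite EK; have /cvg_lim <- // := nonincreasing_cvg_mu (mu := P) K0 mK mI Kmono.
apply: lime_ge.
  by apply/cvg_ex; eexists; exact: (nonincreasing_cvg_mu (mu := P) K0 mK mI Kmono).
apply: nearW => n /=; apply/ltW; apply: (heavy_Ls (n := n)) => // u [a aL au].
move: aL; rewrite size_Ls => aL.
exists (rpref a n); split; rewrite ?size_rpref ?addn0//.
  by rewrite drop_rpref// subnn.
by split; rewrite size_rpref// => k kn; rewrite drop_rpref//; exact: au.
Qed.

Lemma souslin_level : exists (G : set T) (a : T -> nat -> nat),
  [/\ measurable G, c%:E <= P G,
      forall n i, measurable [set u | a u n = i] &
      forall u, G u -> branch (a u) u].
Proof.
by exists [set u | extends [::] u], a_; split => //; exact: measurable_extends.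
Qed.

End fixed_level.

(** A point lies in the operation A of the scheme as soon as it has a branch.
    The map selecting a branch cannot be taken measurable everywhere, but up to
    a set of small measure the branches may be restricted to a finitely
    branching tree, chosen one level at a time by continuity of the outer
    measure along increasing unions. In such a tree, Koenig's lemma makes
    the set of extendible nodes measurable, hence the leftmost branch too. *)
Lemma souslin_selection : (forall u, exists a, branch a u) ->
  exists a : T -> nat -> nat,
    (forall n i, measurable [set u | a u n = i]) /\
    {ae P, forall u, branch (a u) u}.
Proof.
move=> branchT.
have c_lt1 m : (1 - m.+1%:R^-1 < 1 :> R)%R.
  by rewrite ltrBlDr ltrDl invr_gt0 ltr0n.
have lev m : {Ga : set T * (T -> nat -> nat) |
    [/\ measurable Ga.1, (1 - m.+1%:R^-1)%:E <= P Ga.1,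
      forall n i, measurable [set u | Ga.2 u n = i] &
      forall u, Ga.1 u -> branch (Ga.2 u) u]}.
  apply/cid; have [G [a Ga]] := souslin_level (c_lt1 m) branchT.
  by exists (G, a).
pose G m := (sval (lev m)).1; pose b m := (sval (lev m)).2.
have mG m : measurable (G m) by rewrite /G; case: (svalP (lev m)).
have PG m : (1 - m.+1%:R^-1)%:E <= P (G m).
  by rewrite /G; case: (svalP (lev m)).
have mb m n i : measurable [set u | b m u n = i].
  by rewrite /b; case: (svalP (lev m)).
have bG m u : G m u -> branch (b m u) u.
  by rewrite /b /G; case: (svalP (lev m)) => _ _ _; exact.
pose idx u := least_nat (G^~ u).
have midx m : measurable [set u | idx u = m] by exact: measurable_least_nat.
exists (fun u => b (idx u) u); split.
  move=> n i; have -> : [set u | b (idx u) u n = i] =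
      [set u | exists m, idx u = m /\ b m u n = i].
    by apply/seteqP; split => u /=; [exists (idx u) | case=> m [<-]].
  by apply: measurable_exists => m; exact: measurable_conj.
have mU : measurable (\bigcup_m G m) by exact: bigcupT_measurable.
exists (~` \bigcup_m G m); split.
- exact: measurableC.
- suff PU : P (\bigcup_m G m) = 1 by rewrite probability_setC// PU subee.
  apply/eqP; rewrite eq_le probability_le1//=.
  apply/lee_addgt0Pr => e e0.
  have [m] : exists m, (m.+1%:R^-1 < e)%R.
    exists (Num.truncn e^-1); rewrite invf_plt ?posrE ?ltr0n//.
    exact: truncnS_gt.
  move=> me; apply: (@le_trans _ _ (P (G m) + e%:E)); last first.
    by apply: leeD2r; apply: le_measure; rewrite ?inE//; exact: bigcup_sup.
  apply: (@le_trans _ _ ((1 - m.+1%:R^-1)%:E + e%:E)); last exact: leeD2r.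
  by rewrite -EFinD lee_fin -addrA lerDl addrC subr_ge0 ltW.
- move=> u /= nb [m _ Gu]; apply: nb; apply: bG.
  by apply: (least_natP (Q := G^~ u)); exists m.
Qed.

End souslin.

(** * Borel maps into a separable metric space *)

Lemma invS_lt (R : realType) (e : R) : (0 < e)%R ->
  exists n : nat, (n.+1%:R^-1 < e)%R.
Proof.
move=> e0; exists (Num.truncn e^-1); rewrite invf_plt ?posrE ?ltr0n//.
exact: truncnS_gt.
Qed.

Section metric_facts.
Context (R : realType) (M : metricType R).

Definition dense_seq (D : nat -> M) :=
  forall z (e : R), (0 < e)%R -> exists n, (mdist z (D n) < e)%R.

Definition converges_to (x : nat -> M) (z : M) := forall e : R, (0 < e)%R ->
  exists N, forall k, (N <= k)%N -> (mdist (x k) z < e)%R.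

Definition cauchy_seq (x : nat -> M) := forall e : R, (0 < e)%R ->
  exists N, forall k l, (N <= k)%N -> (N <= l)%N -> (mdist (x k) (x l) < e)%R.

Lemma open_ballP (V : set M) z : open V -> V z ->
  exists2 e : R, (0 < e)%R & forall w, (mdist z w < e)%R -> V w.
Proof.
move=> oV Vz; have : nbhs z V by exact: open_nbhs_nbhs.
move=> /nbhs_ballP[e /= e0 zV]; exists e => // w zw.
by apply: zV; rewrite ballEmdist.
Qed.

Lemma open_mdist_lt z (r : R) : open [set w : M | (mdist z w < r)%R].
Proof.
rewrite openE => w /= zw; apply/nbhs_ballP; exists (r - mdist z w)%R => /=.
  by rewrite subr_gt0.
move=> v; rewrite ballEmdist /= => wv.
by rewrite (le_lt_trans (metric_triangle z w v))// -ltrBrDl.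
Qed.

Lemma separable_dense_seq : separable_space M -> M -> exists D, dense_seq D.
Proof.
move=> [D0 cD dD] z0.
have near z (e : R) : (0 < e)%R -> exists2 w, D0 w & (mdist z w < e)%R.
  move=> e0; have [] := dD [set w | (mdist z w < e)%R].
  - by exists z; rewrite /= mdistxx.
  - exact: open_mdist_lt.
  - by move=> w [/= zw Dw]; exists w.
have /countable_injP[f finj] := cD.
pose D n := if pselect (exists w, D0 w /\ f w = n) is left h
  then sval (cid h) else z0.
exists D => z e e0; have [w Dw zw] := near z e e0; exists (f w).
rewrite /D; case: pselect => [h|[]]; last by exists w.
case: (cid h) => v /= [Dv fvw].
by rewrite (finj v w) ?inE.
Qed.

Lemma cauchy_seq_cvg (x : nat -> M) : complete_space M -> cauchy_seq x ->
  exists z, converges_to x z.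
Proof.
move=> cM cx; have [|z xz] := cM (x n @[n --> \oo]) _.
  apply/cauchy_exP => e e0; have [N xN] := cx e e0.
  exists (x N), N => // k /= Nk; rewrite ballEmdist /=; exact: xN.
exists z => e e0; have := xz _ (nbhsx_ballx z e e0).
move=> [N _ xN]; exists N => k Nk; have := xN k Nk.
by rewrite /= ballEmdist /= metric_sym.
Qed.

Lemma converges_to_unique (x : nat -> M) z w :
  converges_to x z -> converges_to x w -> z = w.
Proof.
move=> xz xw; apply: mdist_positivity; apply/eqP; rewrite eq_le mdist_ge0 andbT.
apply/ler_addgt0Pl => e e0; rewrite addr0.
have e20 : (0 < e / 2)%R by rewrite divr_gt0.
have [N1 xN1] := xz _ e20; have [N2 xN2] := xw _ e20.
rewrite (le_trans (metric_triangle z (x (maxn N1 N2)) w))//.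
rewrite [leRHS]splitr lerD// ltW//; first by rewrite metric_sym xN1// leq_maxl.
by rewrite xN2// leq_maxr.
Qed.

Lemma mdist_dist (x x' y y' : M) :
  (`|mdist x y - mdist x' y'| <= mdist x x' + mdist y y')%R.
Proof.
have t1 := metric_triangle x x' y; have t2 := metric_triangle x' y' y.
have t3 := metric_triangle x' x y'; have t4 := metric_triangle x y y'.
rewrite ler_norml; apply/andP; split.
  by rewrite (metric_sym x' x) in t3; lra.
by rewrite (metric_sym y' y) in t2; lra.
Qed.

End metric_facts.

Section borel_maps.
Context d (T : measurableType d) (Z : topologicalType).

Lemma borel_measurable_open (f : T -> Z) :
  (forall V, open V -> measurable (f @^-1` V)) -> borel_measurable f.
Proof.
move=> mf A sA.
suff : <<s @open Z >> `<=` [set A | measurable (f @^-1` A)] by exact.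
apply: smallest_sub => //; split => /=.
- by rewrite preimage_set0.
- by move=> B mB; rewrite setTD preimage_setC; exact: measurableC.
- by move=> F mF; rewrite preimage_bigcup; exact: bigcupT_measurable.
Qed.

Lemma borel_measurable_comp d' (S : measurableType d') (f : T -> Z)
    (g : S -> T) : measurable_fun setT g -> borel_measurable f ->
  borel_measurable (f \o g).
Proof.
move=> mg mf A sA; rewrite comp_preimage.
by apply: measurable_preimage => //; exact: mf.
Qed.

Lemma borel_measurable_cst (z : Z) : borel_measurable (fun _ : T => z).
Proof. by move=> A _; exact: measurable_prop. Qed.

Lemma borel_measurable_countable (E : countType) (i : T -> E) (f : E -> T -> Z) :
  (forall n, measurable [set u | i u = n]) -> (forall n, borel_measurable (f n)) ->
  borel_measurable (fun u => f (i u) u).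
Proof.
move=> mi mf A sA; rewrite (_ : _ @^-1` _ =
  [set u | exists n, i u = n /\ A (f n u)]); last first.
  by apply/seteqP; split => u /=; [exists (i u) | case=> n [<-]].
apply: measurable_exists => n; apply: measurable_conj => //; exact: mf.
Qed.

End borel_maps.

Lemma borel_measurable_continuous d (T : measurableType d)
    (Z Y : topologicalType) (f : T -> Z) (g : Z -> Y) :
  continuous g -> borel_measurable f ->
  borel_measurable (g \o f).
Proof.
move=> cg mf; apply: borel_measurable_open => V oV; rewrite comp_preimage.
by apply: mf; apply: sub_sigma_algebra; apply: open_comp => // z _; exact: cg.
Qed.

Section measurable_comparisons.
Context d (T : measurableType d) (R : realType) (f : T -> R).
Hypothesis mf : measurable_fun setT f.

Lemma measurable_lt_cst (r : R) : measurable [set u | (f u < r)%R].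
Proof.
have := mf measurableT (measurable_itv `]-oo, r[); rewrite setTI.
by congr measurable; apply/seteqP; split => u /=; rewrite in_itv.
Qed.

Lemma measurable_le_cst (r : R) : measurable [set u | (f u <= r)%R].
Proof.
have := mf measurableT (measurable_itv `]-oo, r]); rewrite setTI.
by congr measurable; apply/seteqP; split => u /=; rewrite in_itv.
Qed.

End measurable_comparisons.

Section borel_metric.
Context d (T : measurableType d) (R : realType) (Z : metricType R).
Variable D : nat -> Z.
Hypothesis Ddense : dense_seq D.

Lemma borel_mdist_lt (a : T -> Z) z (r : R) : borel_measurable a ->
  measurable [set u | (mdist z (a u) < r)%R].
Proof.
move=> ma; apply: (ma [set w | (mdist z w < r)%R]).
by apply: sub_sigma_algebra; exact: open_mdist_lt.
Qed.

(** A distance less than r is witnessed by a point of the dense sequence. *)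
Lemma measurable_mdist (a b : T -> Z) :
  borel_measurable a -> borel_measurable b ->
  measurable_fun setT (fun u => mdist (a u) (b u)).
Proof.
move=> ma mb; apply: (measurability _ (RGenInftyO.measurableE R)).
move=> _ [_ [r ->] <-]; rewrite setTI.
rewrite (_ : _ @^-1` _ = [set u | exists n j, (mdist (D n) (a u) < j.+1%:R^-1)%R
   /\ (mdist (D n) (b u) < r - j.+1%:R^-1)%R]).
  apply: measurable_exists => n; apply: measurable_exists => j.
  by apply: measurable_conj; exact: borel_mdist_lt.
apply/seteqP; split => u /=; rewrite in_itv /=; last first.
  move=> [n [j [an bn]]].
  have := metric_triangle (a u) (D n) (b u).
  rewrite (metric_sym (a u) (D n)).
  by move: (j.+1%:R^-1)%R an bn => x; lra.
move=> abr; have g0 : (0 < (r - mdist (a u) (b u)) / 2)%R by lra.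
have [j jg] := invS_lt g0.
have j0 : (0 < j.+1%:R^-1 :> R)%R by rewrite invr_gt0 ltr0n.
have [n an] := Ddense (a u) j0; exists n, j.
have := metric_triangle (D n) (a u) (b u); rewrite (metric_sym (D n) (a u)).
move: (j.+1%:R^-1)%R jg an => x; lra.
Qed.

(** The limit lies in an open set V exactly when the sequence eventually stays in
    an open ball around a point of the dense sequence whose closure is contained
    in V. *)
Lemma borel_measurable_limit (f : nat -> T -> Z) (h : T -> Z) :
  (forall k, borel_measurable (f k)) ->
  (forall u, converges_to (f^~ u) (h u)) -> borel_measurable h.
Proof.
move=> mf fh; apply: borel_measurable_open => V oV.
rewrite (_ : _ @^-1` _ = [set u | exists n j, (forall w,
    (mdist (D n) w <= j.+1%:R^-1)%R -> V w) /\
    (exists N, forall k, (N <= k)%N -> (mdist (D n) (f k u) < j.+1%:R^-1)%R)]).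
  apply: measurable_exists => n; apply: measurable_exists => j.
  apply: measurable_conj; first exact: measurable_prop.
  apply: measurable_exists => N; apply: measurable_forall => k.
  by apply: measurable_imply => _; exact: borel_mdist_lt.
apply/seteqP; split => u /=; last first.
  move=> [n [j [nV [N fN]]]]; apply: nV; apply/ler_addgt0Pl => e e0.
  have [N' hN'] := fh u e e0; have := fN (maxn N N') (leq_maxl _ _).
  have := hN' (maxn N N') (leq_maxr _ _).
  have := metric_triangle (D n) (f (maxn N N') u) (h u).
  move: (j.+1%:R^-1)%R => x; lra.
move=> Vh; have [e e0 eV] := open_ballP oV Vh.
have e30 : (0 < e / 3)%R by rewrite divr_gt0.
have [j je] := invS_lt e30.
have j0 : (0 < j.+1%:R^-1 / 2 :> R)%R by rewrite divr_gt0// invr_gt0 ltr0n.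
have [n hn] := Ddense (h u) j0; exists n, j; split.
  move=> w wn; apply: eV; have := metric_triangle (h u) (D n) w.
  move: (j.+1%:R^-1)%R je j0 hn wn => x; lra.
have [N hN] := fh u _ j0; exists N => k Nk; have := hN k Nk.
have := metric_triangle (D n) (h u) (f k u).
rewrite (metric_sym (D n) (h u)) (metric_sym (h u) (f k u)).
move: (j.+1%:R^-1)%R je j0 hn => x; lra.
Qed.

(** The sequence is Cauchy on a measurable set; elsewhere it is replaced by a
    constant one. *)
Lemma borel_cauchy_limit (f : nat -> T -> Z) : complete_space Z ->
  (forall k, borel_measurable (f k)) -> exists h : T -> Z,
  borel_measurable h /\
  forall u, cauchy_seq (f^~ u) -> converges_to (f^~ u) (h u).
Proof.
move=> cZ mf.
pose C := [set u | cauchy_seq (f^~ u)].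
have mC : measurable C.
  rewrite (_ : C = [set u | forall j : nat, exists N, forall k l, (N <= k)%N ->
      (N <= l)%N -> (mdist (f k u) (f l u) < j.+1%:R^-1)%R]); last first.
    apply/seteqP; split => u /=; first by move=> cu j; apply: cu; rewrite invr_gt0.
    move=> cu e e0; have [j je] := invS_lt e0; have [N cN] := cu j.
    by exists N => k l Nk Nl; apply: lt_trans je; exact: cN.
  apply: measurable_forall => j; apply: measurable_exists => N.
  apply: measurable_forall => k; apply: measurable_forall => l.
  apply: measurable_imply => _; apply: measurable_imply => _.
  apply: measurable_lt_cst; exact: measurable_mdist.
pose i u := `[< C u >].
have mi b : measurable [set u | i u = b].
  case: b; rewrite /i.
    suff -> : [set u | `[< C u >] = true] = C by [].
    by apply/seteqP; split => u /= /asboolP.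
  suff -> : [set u | `[< C u >] = false] = ~` C by exact: measurableC.
  by apply/seteqP; split => u /=; [move=> /negbT /asboolPn|move=> /asboolPn /negbTE].
pose g k u := if i u then f k u else D 0%N.
have mg k : borel_measurable (g k).
  apply: (borel_measurable_countable (i := i)
    (f := fun (b : bool) u => if b then f k u else D 0%N)) => // -[].
    exact: mf.
  exact: borel_measurable_cst.
have /choice[h gh] u : exists z, converges_to (g^~ u) z.
  rewrite /g; have [Cu|nCu] := boolP (i u).
    by apply: cauchy_seq_cvg => //; exact/asboolP.
  by exists (D 0%N) => e e0; exists 0%N => k _; rewrite mdistxx.
exists h; split; first exact: borel_measurable_limit mg gh.
move=> u Cu; have := gh u; rewrite /g; suff -> : i u by [].
exact/asboolP.
Qed.

End borel_metric.

(** * Measurable selection of geodesics *)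

Lemma nth_rev_rpref (a : nat -> nat) n i : (i < n)%N ->
  nth 0%N (rev (rpref a n)) i = a i.
Proof.
move=> ni; rewrite nth_rev ?size_rpref//.
suff nthE m k : (k < m)%N -> nth 0%N (rpref a m) k = a (m - k.+1)%N.
  by rewrite nthE; [congr a; lia | lia].
by elim: m k => // m IH [|k] /= km; rewrite ?subSS ?subn0// IH.
Qed.

Section geodesic_selection.
Context d (T : measurableType d) (R : realType) (P : probability T R).
Context (Z : metricType R) (D : nat -> Z).
Hypothesis Ddense : dense_seq D.
Hypothesis Zcomplete : complete_space Z.
Hypothesis Zgeodesic : geodesic (fun z z' : Z => (mdist z z')%:E).
Variables a b : T -> Z.
Hypotheses (ma : borel_measurable a) (mb : borel_measurable b).

Let prec (k : nat) : R := k.+1%:R^-1.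

Let prec_gt0 k : (0 < prec k)%R. Proof. by rewrite invr_gt0 ltr0n. Qed.

(** Entry i of a code carries a denominator, through the second component of
    decode i, and a numerator, through the first; Num.min keeps the time within
    [0, 1]. *)
Let decode (i : nat) : nat * nat := odflt (0%N, 0%N) (unpickle i).
Let time (i : nat) : R :=
  Num.min 1%R ((decode i).1%:R * prec (decode i).2)%R.
Let code (t : R) (k : nat) : nat :=
  pickle (Num.truncn (t * k.+1%:R)%R, k).

Let code_prec t k : (decode (code t k)).2 = k.
Proof. by rewrite /decode /code pickleK. Qed.

Let code_time t k : (0 <= t <= 1)%R ->
  (`|time (code t k) - t| <= prec k)%R.
Proof.
move=> /andP[t0 t1]; rewrite /time /decode /code pickleK /=.
have k0 : (0 < k.+1%:R :> R)%R by rewrite ltr0n.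
have := truncn_itv (mulr_ge0 t0 (ltW k0)).
move: (Num.truncn _) => m /andP[mt tm].
have le1 : (m%:R * prec k <= t)%R by rewrite /prec ler_pdivrMr.
rewrite (min_idPr _); last exact: le_trans le1 t1.
have lt1 : (t <= m%:R * prec k + prec k)%R.
  by rewrite -[X in (_ + X)%R]mul1r -mulrDl natr1 /prec ler_pdivlMr// ltW.
by rewrite ler_norml; apply/andP; split; move: (prec_gt0 k); lra.
Qed.

Let code_time0 k : time (code 0%R k) = 0%R.
Proof.
by rewrite /time /decode /code pickleK /= mul0r truncn0 mul0r (min_idPr _).
Qed.

Let code_time1 k : time (code 1%R k) = 1%R.
Proof.
by rewrite /time /decode /code pickleK /= mul1r natrK /prec divff ?minxx.
Qed.

Let time_itv i : (0 <= time i <= 1)%R.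
Proof.
rewrite /time ge_min lexx /= le_min ler01 /=.
by rewrite mulr_ge0// ltW.
Qed.

(** What must hold if D x and D x' approximate the points of a geodesic from a u
    to b u at the times of the entries i and i', within their precisions. *)
Let constraint i x i' x' u :=
  [/\ (`|mdist (D x) (D x') - `|time i - time i'| * mdist (a u) (b u)|
         <= prec (decode i).2 + prec (decode i').2)%R,
      (time i = 0 -> mdist (a u) (D x) <= prec (decode i).2)%R &
      (time i = 1 -> mdist (b u) (D x) <= prec (decode i).2)%R].

Let constraints (s : seq nat) : set T := [set u |
  forall i i', (i < size s)%N -> (i' < size s)%N ->
    constraint i (nth 0%N (rev s) i) i' (nth 0%N (rev s) i') u].

Let measurable_constraints s : measurable (constraints s).
Proof.
apply: measurable_forall => i; apply: measurable_forall => i'.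
apply: measurable_imply => _; apply: measurable_imply => _.
move: (nth _ _ i) (nth _ _ i') => x x'.
rewrite (_ : [set _ | _] = [set u |
    (`|mdist (D x) (D x') - `|time i - time i'| * mdist (a u) (b u)|
         <= prec (decode i).2 + prec (decode i').2)%R /\
    ((time i = 0%R -> (mdist (a u) (D x) <= prec (decode i).2)%R) /\
     (time i = 1%R -> (mdist (b u) (D x) <= prec (decode i).2)%R))]); last first.
  by apply/seteqP; split => u /= [] // ? [].
apply: measurable_conj.
  apply: measurable_le_cst; apply: measurableT_comp => //.
  apply: measurable_funB => //; apply: measurable_funM => //.
  exact: (measurable_mdist Ddense).
apply: measurable_conj; apply: measurable_imply => _.
  apply: measurable_le_cst; apply: (measurable_mdist Ddense) => //.
  exact: borel_measurable_cst.
apply: measurable_le_cst; apply: (measurable_mdist Ddense) => //.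
exact: borel_measurable_cst.
Qed.

Let constraints_branch u : exists al, forall k, constraints (rpref al k) u.
Proof.
have [g [g0 g1 gd]] := Zgeodesic (a u) (b u).
have /choice[al alP] i : exists n,
    (mdist (g (time i)) (D n) < prec (decode i).2)%R by exact: Ddense.
exists al => k i i'; rewrite size_rpref => ik i'k; rewrite !nth_rev_rpref//.
split.
- have := gd (time i) (time i') (time_itv i) (time_itv i').
  rewrite -EFinM => -[] gE; rewrite (distrC (time i)) -gE distrC.
  rewrite (le_trans (mdist_dist _ _ _ _))//.
  by rewrite lerD// ltW.
- by move=> i0; rewrite -g0 -i0 ltW.
- by move=> i1; rewrite -g1 -i1 ltW.
Qed.

(** A geodesic is coded by indices of points of a dense sequence approximating
    it at rational times. The codes of geodesics from a u to b u are the branches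
    of a Souslin scheme of measurable sets, so one can be chosen measurably for
    almost every u; the geodesic is recovered from its code by completeness. *)
Lemma geodesic_selection : exists h : R -> T -> Z,
  (forall t, borel_measurable (h t)) /\
  {ae P, forall u, [/\ h 0%R u = a u, h 1%R u = b u &
    forall s t : R, (0 <= s <= 1)%R -> (0 <= t <= 1)%R ->
      mdist (h s u) (h t u) = (`|t - s| * mdist (a u) (b u))%R]}.
Proof.
have [al [mal alP]] :=
  souslin_selection P measurable_constraints constraints_branch.
have alP' u : (forall k, constraints (rpref (al u) k) u) ->
    forall i i', constraint i (al u i) i' (al u i') u.
  move=> cu i i'; have := cu (maxn i i').+1 i i'.
  by rewrite size_rpref !nth_rev_rpref ?ltnS ?leq_maxl ?leq_maxr//; exact.
pose f t k u := D (al u (code t k)).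
have mf t k : borel_measurable (f t k).
  apply: (borel_measurable_countable (i := fun u => al u (code t k))
    (f := fun n _ => D n)) => // n; exact: borel_measurable_cst.
have /choice[h hP] t := borel_cauchy_limit Ddense Zcomplete (mf t).
exists h; split; first by move=> t; case: (hP t).
apply: filterS alP => u /alP' cu.
pose L := mdist (a u) (b u).
have L0 : (0 <= L)%R by exact: mdist_ge0.
have fE s t k l : (0 <= s <= 1)%R -> (0 <= t <= 1)%R ->
    (`|mdist (f s k u) (f t l u) - `|t - s| * L|
       <= (prec k + prec l) * (1 + L))%R.
  move=> s01 t01; have [c _ _] := cu (code s k) (code t l).
  rewrite !code_prec in c.
  have ts := code_time k s01; have tt := code_time l t01.
  have dd : (`| `|time (code s k) - time (code t l)| - `|t - s| |
      <= prec k + prec l)%R.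
    rewrite (distrC t) (le_trans (ler_dist_dist _ _))//.
    rewrite (_ : (_ - _ - _)%R = ((time (code s k) - s) -
      (time (code t l) - t))%R); last by ring.
    by rewrite (le_trans (ler_normB _ _))// lerD.
  rewrite (_ : (mdist _ _ - _)%R = ((mdist (f s k u) (f t l u) -
     `|time (code s k) - time (code t l)| * L) +
     (`|time (code s k) - time (code t l)| - `|t - s|) * L)%R); last by ring.
  rewrite (le_trans (ler_normD _ _))// mulrDr mulr1 lerD//.
  by rewrite normrM (ger0_norm L0) ler_wpM2r.
have small (e : R) : (0 < e)%R -> exists N, forall k, (N <= k)%N ->
    (prec k * (1 + L) < e)%R.
  move=> e0; have L1 : (0 < 1 + L)%R by rewrite ltr_wpDr.
  have [N Ne] := invS_lt (divr_gt0 e0 L1); exists N => k Nk.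
  rewrite -ltr_pdivlMr// (le_lt_trans _ Ne)// lef_pV2 ?posrE ?ltr0n//.
  by rewrite ler_nat ltnS.
have fh t : (0 <= t <= 1)%R -> converges_to (fun k => f t k u) (h t u).
  move=> t01; have [_] := hP t; apply => e e0.
  have [N NP] := small (e / 2)%R (divr_gt0 e0 (ltr0Sn _ _)); exists N => k l Nk Nl.
  have := fE t t k l t01 t01; rewrite subrr normr0 mul0r subr0.
  rewrite ger0_norm ?mdist_ge0// => /le_lt_trans; apply.
  by rewrite mulrDl [ltRHS]splitr ltrD// NP.
have i0 : (0 <= (0 : R) <= 1)%R by rewrite lexx ler01.
have i1 : (0 <= (1 : R) <= 1)%R by rewrite lexx ler01.
have toend z t : (0 <= t <= 1)%R -> (forall k, (mdist z (f t k u) <= prec k)%R) ->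
    h t u = z.
  move=> t01 zf; apply: (converges_to_unique (fh t t01)) => e e0.
  have [N NP] := small e e0; exists N => k Nk.
  rewrite metric_sym (le_lt_trans (zf k))// (le_lt_trans _ (NP k Nk))//.
  by rewrite ler_peMr ?lerDl// ltW.
split.
- apply: toend => // k; have [_ c0 _] := cu (code 0 k) (code 0 k).
  by have := c0 (code_time0 k); rewrite code_prec.
- apply: toend => // k; have [_ _ c1] := cu (code 1 k) (code 1 k).
  by have := c1 (code_time1 k); rewrite code_prec.
- move=> s t s01 t01; apply/eqP; rewrite -subr_eq0 -normr_le0.
  apply/ler_addgt0Pl => e e0; rewrite addr0.
  have e40 : (0 < e / 4)%R by rewrite divr_gt0.
  have [N NP] := small _ e40.
  have [N1 fN1] := fh s s01 _ e40; have [N2 fN2] := fh t t01 _ e40.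
  pose k := (N + (N1 + N2))%N.
  have k0 := NP k (leq_addr _ _).
  have k1 := fN1 k (leq_trans (leq_addr _ _) (leq_addl _ _)).
  have k2 := fN2 k (leq_trans (leq_addl _ _) (leq_addl _ _)).
  have := fE s t k k s01 t01; have := mdist_dist (h s u) (f s k u) (h t u) (f t k u).
  rewrite (metric_sym (h s u) (f s k u)) (metric_sym (h t u) (f t k u)) mulrDl.
  move: (mdist (f s k u) (h s u)) k1 (mdist (f t k u) (h t u)) k2 => m1 k1 m2 k2.
  move: (prec k * (1 + L))%R k0 => v k0 xy yw.
  rewrite (le_trans (ler_distD (mdist (f s k u) (f t k u)) _ _))//.
  by rewrite (le_trans (lerD xy yw))//; lra.
Qed.

End geodesic_selection.

(** * Bimeasures *)

(** A finitely additive set function below a finite measure is sigma-additive: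
    the remainders of a disjoint union have small measure. *)
Lemma sub_measure_sigma_additive d (T : measurableType d) (R : realType)
    (mu : probability T R) (c : set T -> R) :
  (forall A, measurable A -> (0 <= c A)%R /\ (c A)%:E <= mu A) ->
  (forall A B, measurable A -> measurable B -> A `&` B = set0 ->
    c (A `|` B) = (c A + c B)%R) ->
  exists nu : {finite_measure set T -> \bar R},
    forall A, measurable A -> nu A = (c A)%:E.
Proof.
move=> cmu cU.
have c0 : c set0 = 0%R.
  by have := cU set0 set0 measurable0 measurable0 (setI0 _); rewrite setU0; lra.
pose f (A : set T) : \bar R := if `[< measurable A >] then (c A)%:E else 0.
have fE A : measurable A -> f A = (c A)%:E by move=> mA; rewrite /f asboolT.
have f0 : f set0 = 0 by rewrite fE// c0.
have f_ge0 A : 0 <= f A.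
  by rewrite /f; case: asboolP => // mA; rewrite lee_fin; case: (cmu A mA).
have fs : semi_sigma_additive f.
  move=> F mF tF mUF; rewrite fE//.
  rewrite [X in X @ _](_ : _ = (fun n => (\sum_(0 <= i < n) c (F i))%R%:E)); last first.
    apply/funext => n; rewrite -sumEFin; apply: eq_bigr => i _.
    by rewrite fE.
  apply: cvg_EFin; first exact: nearW.
  pose U := \bigcup_n F n.
  pose V n := \big[setU/set0]_(0 <= i < n) F i.
  have mV n : measurable (V n) by apply: bigsetU_measurable.
  have VU n : V n `<=` U by rewrite /V -bigcup_seq => x [i _ Fi]; exists i.
  have cV n : c (V n) = (\sum_(0 <= i < n) c (F i))%R.
    elim: n => [|n IH]; first by rewrite /V !big_nil.
    rewrite /V !big_nat_recr//= cU//; first by rewrite IH.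
      exact: mV.
    rewrite -bigcup_seq setI_bigcupl; apply: bigcup0 => i /=.
    rewrite mem_index_iota => /andP[_ ni].
    by move/trivIsetP : tF => /(_ i n I I); apply; rewrite neq_ltn ni.
  have muV n : mu (V n) = \sum_(0 <= i < n) mu (F i).
    rewrite /V !big_mkord measure_semi_additive_ord//.
    - by apply/trivIsetP => i j _ _ ij; move/trivIsetP : tF; apply.
    - by rewrite -(big_mkord xpredT); exact: mV.
  have lo n : (c U - (fine (mu U) - fine (mu (V n))) <=
      \sum_(0 <= i < n) c (F i))%R.
    rewrite -cV -{1}(setDUK (VU n)) cU//; last 2 first.
    - exact: measurableD.
    - by rewrite setDE setICA setICr setI0.
    have [_] := cmu _ (measurableD mUF (mV n)).
    have muD : fine (mu (U `\` V n)) = (fine (mu U) - fine (mu (V n)))%R.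
      rewrite measureD//; last by rewrite (le_lt_trans (probability_le1 _ _)) ?ltry.
      by rewrite setIidr// fineB//; exact: fin_num_measure.
    rewrite -[X in _ <= X]fineK ?fin_num_measure//; last exact: measurableD.
    by rewrite muD lee_fin; lra.
  have hi n : (\sum_(0 <= i < n) c (F i) <= c U)%R.
    rewrite -cV -{1}(setDUK (VU n)) cU//; last 2 first.
    - exact: measurableD.
    - by rewrite setDE setICA setICr setI0.
    by have [+ _] := cmu _ (measurableD mUF (mV n)); lra.
  apply: (@squeeze_cvgr _ _ _ _ (fun n => c U - (fine (mu U) -
      fine (mu (V n))))%R (fun=> c U)).
  - by apply: nearW => n; rewrite lo hi.
  - rewrite -[X in _ --> X]subr0 -[X in _ --> (_ - X)%R](subrr (fine (mu U))).
    apply: cvgB; first exact: cvg_cst.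
    apply: cvgB; first exact: cvg_cst.
    have : (mu \o V) n @[n --> \oo] --> mu U.
      rewrite (_ : mu \o V = fun n => \sum_(0 <= i < n) mu (F i)).
        exact: measure_semi_sigma_additive.
      by apply/funext => n /=; rewrite muV.
    move=> VU_cvg; apply: fine_cvg; rewrite fineK; first exact: VU_cvg.
    exact: fin_num_measure.
  - exact: cvg_cst.
pose nu0 : {measure set T -> \bar R} := HB.pack f (isMeasure.Build _ _ _ f f0 f_ge0 fs).
have fin : fin_num_fun nu0 by move=> A mA; rewrite /= fE.
pose nu : {finite_measure set T -> \bar R} :=
  HB.pack f nu0 (Measure_isFinite.Build _ _ _ nu0 fin).
by exists nu => A mA /=; rewrite fE.
Qed.

Section bimeasure.
Context d1 d2 (X : measurableType d1) (Y : measurableType d2) (R : realType).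

(** The values on rectangles of a would-be coupling of mu and nu, known to be
    additive in each variable only. *)
Record bimeasure (mu : probability X R) (nu : probability Y R)
    (m : set X -> set Y -> R) : Prop := Bimeasure {
  bimeasure_ge0 : forall A B, measurable A -> measurable B -> (0 <= m A B)%R ;
  bimeasure_addl : forall A A' B, measurable A -> measurable A' ->
    measurable B -> A `&` A' = set0 -> m (A `|` A') B = (m A B + m A' B)%R ;
  bimeasure_addr : forall A B B', measurable A -> measurable B ->
    measurable B' -> B `&` B' = set0 -> m A (B `|` B') = (m A B + m A B')%R ;
  bimeasure_l : forall A, measurable A -> (m A setT)%:E = mu A ;
  bimeasure_r : forall B, measurable B -> (m setT B)%:E = nu B }.

Context (mu : probability X R) (nu : probability Y R) (m : set X -> set Y -> R).
Hypothesis bm : bimeasure mu nu m.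

Lemma bimeasure_le_l A B : measurable A -> measurable B -> (m A B)%:E <= mu A.
Proof.
move=> mA mB; rewrite -(bimeasure_l bm)// lee_fin -(setUv B).
rewrite (bimeasure_addr bm) ?setICr//; last exact: measurableC.
by rewrite lerDl (bimeasure_ge0 bm)//; exact: measurableC.
Qed.

Lemma bimeasure_le_r A B : measurable A -> measurable B -> (m A B)%:E <= nu B.
Proof.
move=> mA mB; rewrite -(bimeasure_r bm)// lee_fin -(setUv A).
rewrite (bimeasure_addl bm) ?setICr//; last exact: measurableC.
by rewrite lerDl (bimeasure_ge0 bm)//; exact: measurableC.
Qed.

Lemma bimeasure_measure_l B : measurable B ->
  exists f : {finite_measure set X -> \bar R},
    forall A, measurable A -> f A = (m A B)%:E.
Proof.
move=> mB; apply: (sub_measure_sigma_additive (mu := mu) (c := m^~ B)).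
  by move=> A mA; rewrite (bimeasure_ge0 bm)// bimeasure_le_l.
by move=> A A' mA mA' AA'; exact: (bimeasure_addl bm).
Qed.

Lemma bimeasure_measure_r A : measurable A ->
  exists f : {finite_measure set Y -> \bar R},
    forall B, measurable B -> f B = (m A B)%:E.
Proof.
move=> mA; apply: (sub_measure_sigma_additive (mu := nu) (c := m A)).
  by move=> B mB; rewrite (bimeasure_ge0 bm)// bimeasure_le_r.
by move=> B B' mB mB' BB'; exact: (bimeasure_addr bm).
Qed.

End bimeasure.

Lemma density_exists d (X : measurableType d) (R : realType)
    (mu : probability X R) (f : {finite_measure set X -> \bar R}) :
  (forall A, measurable A -> f A <= mu A) ->
  exists g : X -> R, [/\ measurable_fun setT g, forall x, (0 <= g x)%R &
    forall A, measurable A -> \int[mu]_(x in A) (g x)%:E = f A].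
Proof.
move=> fmu; have dom : f `<< mu.
  apply/null_content_dominatesP => A mA muA0; apply/eqP.
  by rewrite eq_le measure_ge0 andbT -muA0 fmu.
pose g x := fine (Radon_Nikodym_SigmaFinite.f f mu x).
have gE x : (g x)%:E = Radon_Nikodym_SigmaFinite.f f mu x.
  by rewrite fineK//; exact: Radon_Nikodym_SigmaFinite.f_fin_num.
exists g; split.
- apply/measurable_EFinP; rewrite (_ : _ \o _ = Radon_Nikodym_SigmaFinite.f f mu).
    by have /integrableP[] := Radon_Nikodym_SigmaFinite.f_integrable dom.
  by apply/funext => x; exact: gE.
- by move=> x; rewrite fine_ge0// Radon_Nikodym_SigmaFinite.f_ge0.
- move=> A mA; rewrite (Radon_Nikodym_SigmaFinite.f_integral dom)//.
  by apply: eq_integral => x _; exact: gE.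
Qed.

Lemma ae_forall_countable d (T : measurableType d) (R : realType)
    (mu : {measure set T -> \bar R}) (I : countType) (P : I -> T -> Prop) :
  (forall i, {ae mu, forall x, P i x}) -> {ae mu, forall x, forall i, P i x}.
Proof.
move=> aeP.
have : {ae mu, forall x, forall n : nat, forall i, unpickle n = Some i -> P i x}.
  apply: ae_foralln => n; case: (unpickle n) => [i|]; last exact: nearW.
  by apply: filterS (aeP i) => x Pix _ [<-].
by apply: filterS => x Px i; apply: (Px (pickle i)); rewrite pickleK.
Qed.

(** * Uniform noise and binary codes *)

Definition unif (R : realType) : probability (measurableTypeR R) R :=
  uniform_prob (@ltr01 R).

Lemma unif_itv (R : realType) (S : set (measurableTypeR R)) (l g : R) :
  measurable S ->
  (0 <= l)%R -> (0 <= g)%R -> (l + g <= 1)%R ->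
  (forall u, (0 <= u < 1)%R -> S u <-> (l <= u < l + g)%R) ->
  unif R S = g%:E.
Proof.
move=> mS l0 g0 lg1 SE.
have itvE (a b : R) : (0 <= a)%R -> (a <= b)%R -> (b <= 1)%R ->
    unif R `[a, b[%classic = (b - a)%:E.
  move=> a0 ab b1; rewrite /unif /= /uniform_prob.
  rewrite (eq_integral (cst 1)).
    rewrite integral_cst//= mul1e lebesgue_measure_itv/= lte_fin.
    case: ifPn => [_|]; first by rewrite -EFinD.
    by rewrite -leNgt => ba; rewrite (le_anti (introT andP (conj ab ba))) subrr.
  move=> x; rewrite inE /= in_itv /= => /andP[ax xb].
  rewrite /uniform_pdf (le_trans a0 ax) (le_trans (ltW xb) b1) subr0 invr1//.
have m01 : measurable (`[0%R, 1%R[%classic : set (measurableTypeR R)) by exact: measurable_itv.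
have u1 : unif R (~` (`[0%R, 1%R[%classic : set (measurableTypeR R))) = 0.
  by rewrite probability_setC// itvE// subr0 subee.
transitivity (unif R (S `&` `[0%R, 1%R[%classic)).
  have mSI : measurable (S `&` `[0%R, 1%R[%classic) by exact: measurableI.
  have mSC : measurable (S `&` ~` `[0%R, 1%R[%classic).
    by apply: measurableI => //; exact: measurableC.
  apply/eqP; rewrite eq_le; apply/andP; split; last first.
    by apply: le_measure; rewrite ?inE.
  rewrite -[in leLHS](setIT S) -(setUv `[0%R, 1%R[%classic) setIUr.
  apply: (le_trans (measureU2 _ mSI mSC)).
  rewrite -[leRHS]adde0; apply: leeD2l; rewrite -u1.
  by apply: le_measure; rewrite ?inE//; exact: measurableC.
rewrite (_ : S `&` _ = `[l, (l + g)%R[%classic).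
  by rewrite itvE ?lerDl// addrC addKr.
apply/seteqP; split => u /=; rewrite !in_itv /=.
  by move=> [Su u01]; apply/SE.
move=> /andP[lu ulg]; have u01 : (0 <= u < 1)%R.
  by rewrite (le_trans l0 lu) (lt_le_trans ulg lg1).
by split => //; apply/SE => //; rewrite lu ulg.
Qed.

(** The sigma-algebra of the Cantor space generated by its cylinders. *)
Definition cylinder (t : seq bool) : set (nat -> bool) :=
  [set b | rpref b (size t) = t].

Definition cylinders : set (set (nat -> bool)) :=
  [set A | A = set0 \/ exists t, A = cylinder t].

Local Notation bits := (g_sigma_algebraType cylinders).

Lemma cylinders_setI : setI_closed cylinders.
Proof.
move=> A B [->|[s ->]]; first by left; rewrite set0I.
move=> [->|[t ->]]; first by left; rewrite setI0.
wlog st : s t / (size s <= size t)%N.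
  move=> H; have [|/ltnW] := leqP (size s) (size t); first exact: H.
  by rewrite setIC; exact: H.
have subE b : cylinder t b -> rpref b (size s) = drop (size t - size s) t.
  by move=> <-; rewrite drop_rpref ?size_rpref ?subKn// leq_subr.
have [tE|tE] := eqVneq (drop (size t - size s) t) s.
  right; exists t; apply/seteqP; split => [b []//|b tb]; split => //.
  by rewrite /cylinder /= subE.
left; apply/seteqP; split => // b [sb /subE bt]; move/eqP: tE; apply.
by rewrite -bt.
Qed.

Lemma measurable_cylinder t : measurable (cylinder t : set bits).
Proof. by apply: sub_sigma_algebra; right; exists t. Qed.

Lemma measurable_bit n : measurable [set b : bits | b n].
Proof.
rewrite (_ : [set _ | _] = [set b : bits | exists t,
    size t = n /\ cylinder (true :: t) b]).
  apply: measurable_exists => t; apply: measurable_conj.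
    exact: measurable_prop.
  exact: measurable_cylinder.
apply/seteqP; split => b /=.
  move=> bn; exists (rpref b n); rewrite size_rpref; split => //.
  by rewrite /cylinder /= size_rpref bn.
by move=> [t [<-]]; rewrite /cylinder /= => -[->].
Qed.

Lemma measurable_fun_bits d (T : measurableType d) (f : T -> bits) :
  (forall n, measurable [set u | f u n]) -> measurable_fun setT f.
Proof.
move=> mf; apply: (@measurability _ _ T bits setT f cylinders) => //.
move=> _ [_ [->|[t ->]] <-]; first by rewrite preimage_set0 setI0.
rewrite setTI; elim: t => [|b t IH].
  by rewrite (_ : _ @^-1` _ = setT)//; apply/seteqP; split.
rewrite (_ : _ @^-1` _ = [set u | f u (size t) = b /\ cylinder t (f u)]).
  apply: measurable_conj => //; case: b; first exact: mf.
  rewrite (_ : [set _ | _] = ~` [set u | f u (size t)]).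
    by apply: measurableC; exact: mf.
  by apply/seteqP; split => u /=; [move=> -> | move/negP/negbTE].
by apply/seteqP; split => u; rewrite /cylinder /= => -[-> ->].
Qed.

(** A measurable retract of the Cantor space. Only a retraction r is asked for, so
    that the image of c need not be known to be measurable. *)
Definition codable d (Y : measurableType d) :=
  exists (c : Y -> bits) (r : bits -> Y),
    [/\ measurable_fun setT c, measurable_fun setT r & cancel c r].

(** * Realising a bimeasure by a randomised map *)

Lemma image_measure d1 d2 (T1 : measurableType d1) (T2 : measurableType d2)
    (R : realType) (mu : {measure set T1 -> \bar R}) (f : T1 -> T2) :
  measurable_fun setT f -> exists nu : {measure set T2 -> \bar R},
    forall A, nu A = mu (f @^-1` A).
Proof.
move=> mf; unshelve eexists (pushforward mu f : {measure set T2 -> \bar R}).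
  exact: mf.
by [].
Qed.

Lemma image_probability d1 d2 (T1 : measurableType d1) (T2 : measurableType d2)
    (R : realType) (mu : probability T1 R) (f : T1 -> T2) :
  measurable_fun setT f -> exists nu : probability T2 R,
    forall A, nu A = mu (f @^-1` A).
Proof.
move=> mf.
pose phi : {mfun T1 >-> T2} := HB.pack f (isMeasurableFun.Build _ _ _ _ f mf).
by exists (distribution mu phi).
Qed.

Section randomisation.
Context d1 d2 (X : measurableType d1) (Y : measurableType d2) (R : realType).
Context (mu : probability X R) (nu : probability Y R) (m : set X -> set Y -> R).
Hypothesis bm : bimeasure mu nu m.
Variables (c : Y -> bits) (r : bits -> Y).
Hypotheses (mc : measurable_fun setT c) (mr : measurable_fun setT r).
Hypothesis cK : cancel c r.

Let B (t : seq bool) : set Y := c @^-1` cylinder t.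

Let mB t : measurable (B t).
Proof. by apply: measurable_preimage => //; exact: measurable_cylinder. Qed.

Let BU t : B t = B (true :: t) `|` B (false :: t).
Proof.
apply/seteqP; split => y.
  rewrite /B /cylinder /= => yt; rewrite yt.
  by case: (c y (size t)); [left|right].
by rewrite /B /cylinder /= => -[|] [].
Qed.

Let BI t : B (true :: t) `&` B (false :: t) = set0.
Proof.
by apply/seteqP; split => // y; rewrite /B /cylinder /= => -[[->]].
Qed.

Variable g : seq bool -> X -> R.
Hypothesis mg : forall t, measurable_fun setT (g t).
Hypothesis g_ge0 : forall t x, (0 <= g t x)%R.
Hypothesis gE : forall t A, measurable A ->
  \int[mu]_(x in A) (g t x)%:E = (m A (B t))%:E.

Let ae_eq_density (f h : X -> R) :
  measurable_fun setT f -> measurable_fun setT h -> (forall x, (0 <= f x)%R) ->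
  (forall x, (0 <= h x)%R) -> \int[mu]_x (f x)%:E < +oo ->
  (forall A, measurable A ->
    \int[mu]_(x in A) (f x)%:E = \int[mu]_(x in A) (h x)%:E) ->
  {ae mu, forall x, f x = h x}.
Proof.
move=> mf mh f0 h0 foo fh.
have : ae_eq mu setT (EFin \o f) (EFin \o h).
  apply: integral_ae_eq => //.
  - apply/integrableP; split; first exact/measurable_EFinP.
    by under eq_integral do rewrite /= ger0_norm//.
  - exact/measurable_EFinP.
  - by move=> A _ mA; exact: fh.
by apply: filterS => x /(_ I) [].
Qed.

Let good x := g [::] x = 1%R /\
  forall t, g t x = (g (true :: t) x + g (false :: t) x)%R.

Let ae_good : {ae mu, forall x, good x}.
Proof.
have g_fin t : \int[mu]_x (g t x)%:E < +oo by rewrite gE// ltry.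
apply: filterI.
  apply: ae_eq_density => // A mA; rewrite gE// integral_cst// mul1e.
  transitivity (m A setT)%:E; last exact: (bimeasure_l bm).
  by congr (m A _)%:E; apply/seteqP; split.
apply: ae_forall_countable => t; apply: ae_eq_density => //.
- exact: measurable_funD.
- by move=> x; rewrite addr_ge0.
- move=> A mA; under [in RHS]eq_integral do rewrite EFinD.
  rewrite ge0_integralD//; try by [move=> x _; rewrite lee_fin].
  - rewrite !gE// -EFinD; congr EFin.
    by rewrite [in LHS]BU (bimeasure_addr bm)// BI.
  - by apply/measurable_EFinP; exact: measurable_funTS.
  - by apply/measurable_EFinP; exact: measurable_funTS.
Qed.

(** Given x, the unit interval is cut, for every n, into intervals of lengths
    g t x, for t of length n; that of t is cut further into those of its two
    extensions, the one by false on the left. *)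
Let left_end (x : X) : seq bool -> R := fix left_end t :=
  if t is b :: t' then (left_end t' + (if b then g (false :: t') x else 0))%R
  else 0%R.

Let measurable_left_end t : measurable_fun setT (left_end^~ t).
Proof.
elim: t => [|[] t IH] /=; first exact: measurable_cst.
- exact: measurable_funD.
- exact: measurable_funD.
Qed.

Let left_end_itv x t : good x ->
  (0 <= left_end x t)%R /\ (left_end x t + g t x <= 1)%R.
Proof.
move=> [g1 gS]; elim: t => [|b t [IH0 IH1]] /=; first by rewrite g1 add0r.
have := gS t; have := g_ge0 (true :: t) x; have := g_ge0 (false :: t) x.
by case: b => ? ? ?; split; lra.
Qed.

(** Where the interval of t is cut. *)
Let threshold (x : X) (t : seq bool) : R := (left_end x t + g (false :: t) x)%R.

Let prefix (p : X * measurableTypeR R) : nat -> seq bool := fix prefix n :=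
  if n is k.+1 then (threshold p.1 (prefix k) <= p.2)%R :: prefix k else [::].

Let code (p : X * measurableTypeR R) : bits :=
  fun n => (threshold p.1 (prefix p n) <= p.2)%R.

Let rpref_code p n : rpref (code p) n = prefix p n.
Proof. by elim: n => //= n ->. Qed.

Let measurable_threshold t (b : bool) : measurable
  [set p : X * measurableTypeR R | (threshold p.1 t <= p.2)%R = b].
Proof.
have mt : measurable [set p : X * measurableTypeR R | (threshold p.1 t <= p.2)%R].
  rewrite (_ : [set _ | _] = [set p : X * measurableTypeR R |
      (threshold p.1 t - p.2 <= 0)%R]); last first.
    by apply/seteqP; split => p /=; rewrite subr_le0.
  apply: measurable_le_cst; apply: measurable_funB.
    apply: (measurableT_comp (f := threshold^~ t)) => //.
    by apply: measurable_funD => //; exact: measurable_left_end.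
  exact: measurable_snd.
case: b => //.
rewrite (_ : [set _ | _] =
  ~` [set p : X * measurableTypeR R | (threshold p.1 t <= p.2)%R]).
  exact: measurableC.
by apply/seteqP; split => p /=; [move=> -> | move/negP/negbTE].
Qed.

Let measurable_prefix n t : measurable [set p | prefix p n = t].
Proof.
elim: n t => [|n IH] t; first exact: (measurable_prop _ ([::] = t)).
case: t => [|b t] /=.
  by rewrite (_ : [set _ | _] = set0)//; apply/seteqP; split.
rewrite (_ : [set _ | _] = [set p | prefix p n = t /\
    (threshold p.1 t <= p.2)%R = b]); last first.
  by apply/seteqP; split => p /=; [move=> [<- <-] | move=> [-> ->]].
apply: measurable_conj; [exact: IH | exact: measurable_threshold].
Qed.

Let measurable_code : measurable_fun setT code.
Proof.
apply: measurable_fun_bits => n.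
rewrite (_ : [set _ | _] = [set p | exists t, prefix p n = t /\
    (threshold p.1 t <= p.2)%R = true]).
  apply: measurable_exists => t; apply: measurable_conj; first exact: measurable_prefix.
  exact: measurable_threshold.
by apply/seteqP; split => p /=; [exists (prefix p n) | move=> [t [<-]]].
Qed.

Let prefixP x u t : good x -> (0 <= u < 1)%R ->
  prefix (x, u) (size t) = t <-> (left_end x t <= u < left_end x t + g t x)%R.
Proof.
move=> gx u01; elim: t => [|b t IH] /=; first by rewrite gx.1 add0r.
have := gx.2 t; have := g_ge0 (true :: t) x; have := g_ge0 (false :: t) x.
move=> g0 g1 gS; split.
  move=> [+ tE]; rewrite tE => bE; have [/(_ tE)+ _] := IH.
  move: bE; rewrite /threshold; case: b => [le1|/negbT]; last rewrite -ltNge => lt1.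
    by rewrite le1 => /andP[? ?] /=; lra.
  by rewrite addr0 lt1 => /andP[-> _].
move=> H; have [_ tE] := IH; rewrite tE /threshold; last first.
  by case: b H => /andP[? ?]; apply/andP; split; lra.
congr (_ :: _); case: b H => /andP[H1 H2] //.
by apply/negbTE; rewrite -ltNge; lra.
Qed.

(** Given a good x, the prefix is t when u falls in an interval of length g t x;
    integrate over A. *)
Let prefix_law A t : measurable A ->
  (mu \x unif R) [set p | A p.1 /\ prefix p (size t) = t] = (m A (B t))%:E.
Proof.
move=> mA; rewrite /product_measure1 -gE// [RHS]integral_mkcond.
set E := [set p | _].
have mE : measurable E.
  apply: measurable_conj; last exact: measurable_prefix.
  exact: (measurable_preimage measurable_fst).
apply: ge0_ae_eq_integral => //.
- exact: measurable_fun_xsection.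
- apply/(measurable_restrictT _ mA); apply/measurable_EFinP.
  exact: measurable_funTS.
- by move=> x _; rewrite erestrict_ge0// => y _; rewrite lee_fin.
apply: filterS ae_good => x gx _ /=; rewrite patchE.
have [L0 L1] := left_end_itv t gx.
case: ifPn => [/set_mem Ax|/negP nAx].
  apply: (unif_itv (l := left_end x t)) => //.
    exact: measurable_xsection.
  move=> u u01; rewrite -prefixP//; rewrite /xsection /= in_setE /E /=.
  by split => [[]|].
rewrite (_ : xsection _ _ = set0) ?measure0//; apply/seteqP; split => // u.
by rewrite /xsection /= in_setE => -[/mem_set].
Qed.

Lemma randomisation_of_density : exists Q : X * measurableTypeR R -> Y,
  measurable_fun setT Q /\ forall A C, measurable A -> measurable C ->
  (mu \x unif R) [set p | A p.1 /\ C (Q p)] = (m A C)%:E.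
Proof.
exists (r \o code); split; first exact: measurableT_comp.
move=> A C mA mC.
have [f fE] := bimeasure_measure_r bm mA.
have mAT : measurable ([set p | A p.1] : set (X * measurableTypeR R)).
  exact: (measurable_preimage measurable_fst).
have [m1 m1E] := image_measure (mrestr (mu \x unif R) mAT) measurable_code.
have [m2 m2E] := image_measure f mc.
have m12 E : measurable E -> m1 E = m2 E.
  move=> mE; apply: (@measure_unique _ _ bits cylinders (fun=> setT) _ _ _ _ m1 m2) => //.
  - exact: cylinders_setI.
  - by move=> _; right; exists [::]; apply/seteqP; split.
  - by rewrite -subTset => x _; exists 0%N.
  - move=> _ [->|[t ->]]; first by rewrite !measure0.
    rewrite m2E [RHS](fE _ (mB t)) -(prefix_law t mA) m1E /mrestr /=.
    apply: (congr1 (product_measure1 mu (unif R))).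
    apply/seteqP; split => p; rewrite /cylinder /= rpref_code; by case.
  - move=> _; rewrite m1E /mrestr.
    apply: (@le_lt_trans _ _ 1); last exact: ltry.
    by apply: probability_le1; rewrite preimage_setT setTI.
have mrC : measurable (r @^-1` C) by exact: measurable_preimage.
have := m12 _ mrC; rewrite m1E m2E /mrestr /=.
have -> : c @^-1` (r @^-1` C) = C by apply/seteqP; split => y /=; rewrite cK.
rewrite fE// => <-; apply: (congr1 (product_measure1 mu (unif R))).
by apply/seteqP; split => p [].
Qed.

End randomisation.

(** A bimeasure comes from a randomised map x |-> Q (x, u), with u uniform in
    [0, 1], as soon as Y is coded by binary sequences: given x, the bits of the
    code are drawn one at a time with the probabilities prescribed by the
    Radon-Nikodym densities of m (_, B), for B a cylinder, with respect to mu. *)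
Lemma randomisation d1 d2 (X : measurableType d1) (Y : measurableType d2)
    (R : realType) (mu : probability X R) (nu : probability Y R)
    (m : set X -> set Y -> R) : bimeasure mu nu m -> codable Y ->
  exists Q : X * measurableTypeR R -> Y,
  measurable_fun setT Q /\ forall A C, measurable A -> measurable C ->
  (mu \x unif R) [set p | A p.1 /\ C (Q p)] = (m A C)%:E.
Proof.
move=> bm [c [r [mc mr cK]]].
have /choice[g gP] (t : seq bool) : exists g : X -> R,
    [/\ measurable_fun setT g, forall x, (0 <= g x)%R &
    forall A, measurable A ->
      \int[mu]_(x in A) (g x)%:E = (m A (c @^-1` cylinder t))%:E].
  have mt : measurable (c @^-1` cylinder t).
    by apply: measurable_preimage => //; exact: measurable_cylinder.
  have [f fE] := bimeasure_measure_l bm mt.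
  have [|g [mg g0 gE]] := @density_exists _ _ _ mu f.
    by move=> A mA; rewrite fE// (bimeasure_le_l bm).
  by exists g; split => // A mA; rewrite gE// fE.
apply: (randomisation_of_density bm mc mr cK (g := g)).
- by move=> t; case: (gP t).
- by move=> t; case: (gP t).
- by move=> t; case: (gP t).
Qed.

(** * Binary codes of Polish spaces *)

Lemma borel_measurable_fun d (T : measurableType d) (X : ptopologicalType)
    (f : T -> borel X) :
  borel_measurable (f : T -> X) -> measurable_fun setT f.
Proof. by move=> mf _ A mA; rewrite setTI; exact: mf. Qed.

(** A point y is coded by the truth values of: y is at distance less than
    1 / (k + 1) from the n-th point of a dense sequence. For each k the first n
    that qualifies gives an approximation of y, and y is their limit. *)
Lemma codable_polish (R : realType) (X : ptopologicalType) :
  polish R X -> codable (borel X).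
Proof.
move=> [M [f [g [cM sM [fK gK] cf cg]]]].
have [D Ddense] := separable_dense_seq sM (f point).
pose decode (i : nat) : nat * nat := odflt (0%N, 0%N) (unpickle i).
have decodeK x : decode (pickle x) = x by rewrite /decode pickleK.
pose c (y : borel X) : bits := fun i =>
  (mdist (f y) (D (decode i).1) < (decode i).2.+1%:R^-1)%R.
pose idx (k : nat) (b : bits) : nat := least_nat (fun n => b (pickle (n, k))).
have mf : borel_measurable (f : borel X -> M).
  apply: borel_measurable_open => V oV; apply: sub_sigma_algebra.
  by apply: open_comp => // x _; exact: cf.
have mc : measurable_fun setT c.
  apply: measurable_fun_bits => i; rewrite /c.
  apply: measurable_lt_cst; apply: (measurable_mdist Ddense) => //.
  exact: borel_measurable_cst.
have midx k n : measurable [set b | idx k b = n].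
  apply: (measurable_least_nat (Q := fun n (b : bits) => b (pickle (n, k)))) => i.
  exact: measurable_bit.
have mx k : borel_measurable (fun b => D (idx k b)).
  apply: (borel_measurable_countable (i := idx k) (f := fun n _ => D n)) => //.
  by move=> n; exact: borel_measurable_cst.
have [h [mh hP]] := borel_cauchy_limit Ddense cM mx.
exists c, (g \o h); split => //.
  by apply: borel_measurable_fun; exact: borel_measurable_continuous.
move=> y; rewrite /= -[RHS](fK y); congr g.
have near k : (mdist (D (idx k (c y))) (f y) < k.+1%:R^-1)%R.
  have k0 : (0 < k.+1%:R^-1 :> R)%R by rewrite invr_gt0 ltr0n.
  have [n yn] := Ddense (f y) _ k0.
  have : c y (pickle (idx k (c y), k)).
    apply: (least_natP (Q := fun n => c y (pickle (n, k)))).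
    by exists n; rewrite /c decodeK.
  by rewrite /c decodeK /= metric_sym.
have cy : converges_to (fun k => D (idx k (c y))) (f y).
  move=> e e0; have [N Ne] := invS_lt e0; exists N => k Nk.
  rewrite (lt_trans (near k))// (le_lt_trans _ Ne)// lef_pV2 ?posrE ?ltr0n//.
  by rewrite ler_nat ltnS.
apply: (converges_to_unique _ cy); apply: hP => e e0.
have [N NP] := cy (e / 2)%R (divr_gt0 e0 (ltr0Sn _ _)); exists N => k l Nk Nl.
apply: (le_lt_trans (metric_triangle _ (f y) _)).
by rewrite [ltRHS]splitr ltrD ?NP// metric_sym NP.
Qed.

Lemma codable_prod d1 d2 (X : measurableType d1) (Y : measurableType d2) :
  codable X -> codable Y -> codable (X * Y)%type.
Proof.
move=> [cx [rx [mcx mrx cxK]]] [cy [ry [mcy mry cyK]]].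
have mbit d (T : measurableType d) (c : T -> bits) n : measurable_fun setT c ->
    measurable [set x | c x n].
  move=> mc; rewrite -[X in measurable X]setTI.
  by apply: (mc measurableT [set b | b n]); exact: measurable_bit.
(* The codes are interleaved. *)
exists (fun p n => if odd n then cy p.2 n./2 else cx p.1 n./2).
exists (fun b => (rx (fun n => b n.*2), ry (fun n => b n.*2.+1))).
split.
- apply: measurable_fun_bits => n; case: (odd n).
    apply: (mbit _ _ (cy \o snd)).
    by apply: measurableT_comp => //; exact: measurable_snd.
  apply: (mbit _ _ (cx \o fst)).
  by apply: measurableT_comp => //; exact: measurable_fst.
- apply: measurable_fun_pair.
    apply: (measurableT_comp mrx).
    by apply: measurable_fun_bits => n; exact: (measurable_bit n.*2).
  apply: (measurableT_comp mry).
  by apply: measurable_fun_bits => n; exact: (measurable_bit n.*2.+1).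
- move=> [x y] /=; congr (_, _).
    by rewrite -[RHS]cxK; congr rx; apply/funext => n; rewrite odd_double doubleK.
  rewrite -[RHS]cyK; congr ry; apply/funext => n.
  by rewrite /= odd_double /= uphalf_double.
Qed.

(** * Norms of real functions on a probability space *)

Section Lnorm_probability.
Context d (T : measurableType d) (R : realType) (P : probability T R).
Implicit Types (f g h : T -> R) (p : \bar R).

Lemma Lnorm_fin (r : R) f :
  Lnorm P r%:E (EFin \o f) = (\int[P]_x (`|f x| `^ r)%:E) `^ r^-1.
Proof. by rewrite unlock; congr (_ `^ _); apply: eq_integral. Qed.

Lemma Lnorm_oo f : Lnorm P +oo (EFin \o f) = ess_sup P (fun x => `|f x|%:E).
Proof. by rewrite unlock /= probability_setT lte01. Qed.

Lemma Lnorm_fin_le (r K : R) f : (0 < r)%R -> (0 <= K)%R ->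
  (Lnorm P r%:E (EFin \o f) <= K%:E) =
  (\int[P]_x (`|f x| `^ r)%:E <= (K `^ r)%:E).
Proof.
move=> r0 K0; rewrite Lnorm_fin.
have I0 : 0 <= \int[P]_x (`|f x| `^ r)%:E.
  by apply: integral_ge0 => x _; rewrite lee_fin powR_ge0.
move: (\int[P]_x _) I0 => I I0.
have ri0 : (0 < r^-1)%R by rewrite invr_gt0.
apply/idP/idP => [IK|IK].
  have := @gt0_ler_poweR R r (ltW r0) (I `^ r^-1) K%:E.
  rewrite !in_itv /= !poweR_ge0 !leey lee_fin K0 => /(_ isT isT IK).
  by rewrite -poweRrM mulVf ?gt_eqF// poweRe1.
have := @gt0_ler_poweR R r^-1 (ltW ri0) I (K `^ r)%:E.
rewrite !in_itv /= I0 !leey lee_fin powR_ge0 => /(_ isT isT IK).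
by rewrite -powRrM mulfV ?gt_eqF// powRr1.
Qed.

Lemma measurable_abs_powR (r : R) f : measurable_fun setT f ->
  measurable_fun setT (fun x => (`|f x| `^ r)%:E).
Proof.
move=> mf; apply/measurable_EFinP.
apply: (@measurableT_comp _ _ _ _ _ _ (@powR R ^~ r)) => //.
exact: measurableT_comp.
Qed.

Lemma le_Lnorm p f g : 1 <= p -> measurable_fun setT f ->
  measurable_fun setT g -> {ae P, forall x, (`|f x| <= `|g x|)%R} ->
  Lnorm P p (EFin \o f) <= Lnorm P p (EFin \o g).
Proof.
move=> p1 mf mg fg; case: p p1 => [r||//] p1; last first.
  by rewrite !Lnorm_oo; apply: le_ess_sup; apply: filterS fg => x; rewrite lee_fin.
have r0 : (0 < r)%R by rewrite (lt_le_trans ltr01).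
rewrite !Lnorm_fin; apply: gt0_ler_poweR.
- by rewrite invr_ge0 ltW.
- by rewrite in_itv /= leey andbT integral_ge0// => x _; rewrite lee_fin powR_ge0.
- by rewrite in_itv /= leey andbT integral_ge0// => x _; rewrite lee_fin powR_ge0.
apply: ae_ge0_le_integral => //.
- exact: (measurable_abs_powR r mf).
- exact: (measurable_abs_powR r mg).
- apply: filterS fg => x fgx _; rewrite lee_fin ge0_ler_powR ?nnegrE//.
  exact: ltW.
Qed.

Lemma Lnorm_cst p (c : R) : 1 <= p -> Lnorm P p (EFin \o cst c) = `|c|%:E.
Proof.
case: p => [r||//] p1.
  rewrite Lnorm_fin (_ : \int[P]_x _ = \int[P]_x (cst (`|c| `^ r)%:E x))//.
  rewrite integral_cst//= probability_setT mule1 /=.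
  by rewrite -powRrM mulfV ?powRr1// gt_eqF// (lt_le_trans ltr01).
by rewrite Lnorm_oo (ess_sup_cst (mu := P) `|c|%:E)//= probability_setT lte01.
Qed.

Lemma Lnorm_scale p (c : R) f : 1 <= p -> (0 <= c)%R -> measurable_fun setT f ->
  Lnorm P p (EFin \o (fun x => c * f x)%R) = c%:E * Lnorm P p (EFin \o f).
Proof.
move=> p1 c0 mf; case: p p1 => [r||//] p1; last first.
  have P0 : 0 < P [set: T] by rewrite probability_setT lte01.
  rewrite !Lnorm_oo -(ess_supZl _ P0)//.
  congr (ess_sup P _); apply/funext => x /=.
  by rewrite normrM ger0_norm.
have r0 : (0 < r)%R by rewrite (lt_le_trans ltr01).
rewrite !Lnorm_fin.
under eq_integral do rewrite normrM powRM// EFinM.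
rewrite ge0_integralZl//.
- rewrite poweRM//.
  + by rewrite /= (ger0_norm c0) -powRrM mulfV ?powRr1// gt_eqF.
  + by apply: integral_ge0 => x _; rewrite lee_fin powR_ge0.
- exact: (measurable_abs_powR r mf).
Qed.

Lemma Lnorm_triangle p f g h : 1 <= p -> measurable_fun setT f ->
  measurable_fun setT g -> measurable_fun setT h ->
  {ae P, forall x, (`|f x| <= `|g x| + `|h x|)%R} ->
  Lnorm P p (EFin \o f) <= Lnorm P p (EFin \o g) + Lnorm P p (EFin \o h).
Proof.
move=> p1 mf mg mh fgh.
have mng : measurable_fun setT (Num.norm \o g) by exact: measurableT_comp.
have mnh : measurable_fun setT (Num.norm \o h) by exact: measurableT_comp.
have normE k : Lnorm P p (EFin \o (Num.norm \o k)) = Lnorm P p (EFin \o k).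
  by rewrite -[RHS]Lnorm_abse.
rewrite -(normE g) -(normE h).
apply: le_trans (eminkowski P mng mnh p1); apply: le_Lnorm => //.
  exact: measurable_funD.
by apply: filterS fgh => x fx; rewrite /= [leRHS]ger0_norm ?addr_ge0.
Qed.

End Lnorm_probability.

Lemma Lnorm_pushforward d1 d2 (T1 : measurableType d1) (T2 : measurableType d2)
    (R : realType) (P : probability T1 R) (Q : probability T2 R) (phi : T1 -> T2)
    (p : \bar R) (f : T2 -> R) : 1 <= p -> measurable_fun setT phi ->
  is_pushforward phi P Q -> measurable_fun setT f ->
  Lnorm Q p (EFin \o f) = Lnorm P p (EFin \o (f \o phi)).
Proof.
move=> p1 mphi PQ mf; case: p p1 => [r||//] p1.
  rewrite !Lnorm_fin; congr (_ `^ _).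
  rewrite (@eq_measure_integral _ _ _ _ (pushforward P phi : {measure set T2 -> \bar R})).
    rewrite ge0_integral_pushforward//.
    exact: (measurable_abs_powR r mf).
  by move=> A mA _; exact/esym/PQ.
have mnf : measurable_fun setT (fun x => `|f x|%:E).
  by apply/measurable_EFinP; exact: measurableT_comp.
have mnfp : measurable_fun setT (fun x => `|f (phi x)|%:E).
  by apply/measurable_EFinP; apply: measurableT_comp => //; exact: measurableT_comp.
rewrite !Lnorm_oo /ess_sup; congr ereal_inf; apply/seteqP.
have aeE y : (\forall x \ae Q, `|f x|%:E <= y) <->
    (\forall x \ae P, `|f (phi x)|%:E <= y).
  rewrite (ae_le_measureP Q y mnf) (ae_le_measureP P y mnfp).
  have mS : measurable ((fun x => `|f x|%:E) @^-1` `]y, +oo[).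
    by apply: measurable_preimage => //; exact: emeasurable_itv.
  by have := PQ _ mS; rewrite /pushforward /= => <-.
by split => y /= /aeE.
Qed.

(** * Compactness of couplings *)

Section ultrafilter_limits.
Context (R : realType) (U : set_system nat).
Hypothesis UU : UltraFilter U.

Lemma ultra_bounded_cvg (a : nat -> R) : (forall n, (0 <= a n <= 1)%R) ->
  exists l : R, a n @[n --> U] --> l.
Proof.
move=> a01; have PU : ProperFilter U by exact: ultra_proper.
have UaU : UltraFilter (a @ U).
  split => [|G PG UG]; first exact: fmap_proper_filter.
  apply/seteqP; split => // A GA.
  have [//|UnA] := in_ultra_setVsetC (a @^-1` A) UU.
  have GnA : G (~` A) by exact: UG.
  by have [x []] := filter_ex (filterI GA GnA).
have := @segment_compact R 0%R 1%R; rewrite compact_ultra => /(_ _ UaU)[|l [_ al]].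
  by apply: (@filterS _ U _ setT) => [n _|]; [rewrite /= in_itv /= a01|exact: filterT].
by exists l.
Qed.

Lemma ultra_cvg_unique (a : nat -> R) (l l' : R) :
  a n @[n --> U] --> l -> a n @[n --> U] --> l' -> l = l'.
Proof.
have PU : ProperFilter U by exact: ultra_proper.
by apply: cvg_unique; exact: norm_hausdorff.
Qed.

End ultrafilter_limits.

Section couplings.
Context d1 d2 (X : measurableType d1) (Y : measurableType d2) (R : realType).
Context (mu : probability X R) (nu : probability Y R).

Definition is_coupling (pi : probability (X * Y)%type R) :=
  is_pushforward fst pi mu /\ is_pushforward snd pi nu.

Lemma bimeasure_coupling pi : is_coupling pi ->
  bimeasure mu nu (fun A B => fine (pi (A `*` B))).
Proof.
move=> [pi1 pi2]; split.
- by move=> A B mA mB; apply: fine_ge0; exact: measure_ge0.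
- move=> A A' B mA mA' mB AA'; rewrite -fineD ?fin_num_measure//;
    try exact: measurableX.
  congr fine; rewrite -measureU//.
  + by congr (pi _); apply/seteqP; split => -[x y] /=; tauto.
  + exact: measurableX.
  + exact: measurableX.
  + by rewrite -setXI AA' set0X.
- move=> A B B' mA mB mB' BB'; rewrite -fineD ?fin_num_measure//;
    try exact: measurableX.
  congr fine; rewrite -measureU//.
  + by congr (pi _); apply/seteqP; split => -[x y] /=; tauto.
  + exact: measurableX.
  + exact: measurableX.
  + by rewrite -setXI BB' setX0.
- move=> A mA; rewrite fineK ?fin_num_measure//; last exact: measurableX.
  by rewrite -pi1//; congr (pi _); apply/seteqP; split => -[x y] // [].
- move=> B mB; rewrite fineK ?fin_num_measure//; last exact: measurableX.
  by rewrite -pi2//; congr (pi _); apply/seteqP; split => -[x y] // [].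
Qed.

(** The coupling is the law of (x, Q (x, u)). *)
Lemma coupling_of_bimeasure m : codable Y -> bimeasure mu nu m ->
  exists pi, is_coupling pi /\
    forall A B, measurable A -> measurable B -> pi (A `*` B) = (m A B)%:E.
Proof.
move=> cY bm; have [Q [mQ QE]] := randomisation bm cY.
have mf : measurable_fun setT (fun p : X * measurableTypeR R => (p.1, Q p)).
  by apply: measurable_fun_pair => //; exact: measurable_fst.
have [pi piE] := image_probability (mu \x unif R) mf.
exists pi; have piAB A B : measurable A -> measurable B ->
  pi (A `*` B) = (m A B)%:E by move=> mA mB; rewrite piE; exact: QE.
split => //; split => [A mA|B mB].
  rewrite -(bimeasure_l bm)// -piAB//; congr (pi _).
  by apply/seteqP; split => -[x y] // [].
rewrite -(bimeasure_r bm)// -piAB//; congr (pi _).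
by apply/seteqP; split => -[x y] // [].
Qed.

Variables (U : set_system nat) (k : nat -> probability (X * Y)%type R).
Hypothesis UU : UltraFilter U.
Hypothesis kc : forall n, is_coupling (k n).

(** Limits along an ultrafilter always exist and respect finite sums, and the
    marginals are constant along the sequence. *)
Lemma bimeasure_ultralimit : exists m, bimeasure mu nu m /\
  forall A B, measurable A -> measurable B ->
    fine (k n (A `*` B)) @[n --> U] --> m A B.
Proof.
have PU : ProperFilter U by exact: ultra_proper.
have /choice[m' m'P] (AB : set X * set Y) : exists l : R,
    measurable AB.1 -> measurable AB.2 ->
    fine (k n (AB.1 `*` AB.2)) @[n --> U] --> l.
  have [mA|] := pselect (measurable AB.1); last by exists 0%R.
  have [mB|] := pselect (measurable AB.2); last by exists 0%R.
  have [|l kl] := @ultra_bounded_cvg R U UU (fun n => fine (k n (AB.1 `*` AB.2))).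
    move=> n; have mAB : measurable (AB.1 `*` AB.2) by exact: measurableX.
    rewrite fine_ge0 ?measure_ge0//= -lee_fin fineK ?probability_le1//.
    exact: fin_num_measure.
  by exists l.
have mP A B : measurable A -> measurable B ->
    fine (k n (A `*` B)) @[n --> U] --> m' (A, B) := m'P (A, B).
exists (fun A B => m' (A, B)); split => //; split.
- move=> A B mA mB; apply: (cvgr_to_ge (mP _ _ mA mB)).
  by apply: nearW => n; apply: fine_ge0; exact: measure_ge0.
- move=> A A' B mA mA' mB AA'.
  apply: (ultra_cvg_unique UU (mP _ _ (measurableU _ _ mA mA') mB)).
  under eq_fun do rewrite (bimeasure_addl (bimeasure_coupling (kc _)))//.
  exact: cvgD (mP _ _ mA mB) (mP _ _ mA' mB).
- move=> A B B' mA mB mB' BB'.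
  apply: (ultra_cvg_unique UU (mP _ _ mA (measurableU _ _ mB mB'))).
  under eq_fun do rewrite (bimeasure_addr (bimeasure_coupling (kc _)))//.
  exact: cvgD (mP _ _ mA mB) (mP _ _ mA mB').
- move=> A mA; rewrite -[RHS]fineK ?fin_num_measure//; congr EFin.
  apply: (ultra_cvg_unique UU (mP _ _ mA measurableT)) => //.
  rewrite (_ : (fun n => _) = cst (fine (mu A))); first exact: cvg_cst.
  by apply/funext => n; have := bimeasure_l (bimeasure_coupling (kc n)) mA => <-.
- move=> B mB; rewrite -[RHS]fineK ?fin_num_measure//; congr EFin.
  apply: (ultra_cvg_unique UU (mP _ _ measurableT mB)) => //.
  rewrite (_ : (fun n => _) = cst (fine (nu B))); first exact: cvg_cst.
  by apply/funext => n; have := bimeasure_r (bimeasure_coupling (kc n)) mB => <-.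
Qed.

Lemma coupling_ultralimit : codable Y -> exists pi, is_coupling pi /\
  forall A B, measurable A -> measurable B ->
    fine (k n (A `*` B)) @[n --> U] --> fine (pi (A `*` B)).
Proof.
move=> cY; have [m [bm mP]] := bimeasure_ultralimit.
have [pi [pic piE]] := coupling_of_bimeasure cY bm.
by exists pi; split => // A B mA mB; rewrite piE//; exact: mP.
Qed.

(** The ultralimit exists on all rectangles anyway, and is a bimeasure. It agrees
    with pi when both sides are in the generating pi-systems, hence everywhere, by
    uniqueness of measures in one variable at a time. *)
Lemma coupling_cvg_ext (pi : probability (X * Y)%type R) (G : set (set X))
    (H : set (set Y)) : is_coupling pi ->
  @measurable _ X = <<s G >> -> setI_closed G -> G setT ->
  @measurable _ Y = <<s H >> -> setI_closed H -> H setT ->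
  (forall A B, G A -> H B ->
    fine (k n (A `*` B)) @[n --> U] --> fine (pi (A `*` B))) ->
  forall A B, measurable A -> measurable B ->
    fine (k n (A `*` B)) @[n --> U] --> fine (pi (A `*` B)).
Proof.
move=> pic mG IG GT mH IH HT kpi.
have PU : ProperFilter U by exact: ultra_proper.
have [m [bm mP]] := bimeasure_ultralimit.
have bpi := bimeasure_coupling pic.
have mGA A : G A -> measurable A by move=> GA; rewrite mG; exact: sub_sigma_algebra.
have mHB B : H B -> measurable B by move=> HB; rewrite mH; exact: sub_sigma_algebra.
have mpi A B : G A -> H B -> m A B = fine (pi (A `*` B)).
  move=> GA HB; apply: (ultra_cvg_unique UU (mP _ _ (mGA _ GA) (mHB _ HB))) => //.
  exact: kpi.
have {}mpi A B : measurable A -> H B -> m A B = fine (pi (A `*` B)).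
  move=> mA HB; apply/EFin_inj.
  have [f1 f1E] := bimeasure_measure_l bm (mHB _ HB).
  have [f2 f2E] := bimeasure_measure_l bpi (mHB _ HB).
  rewrite -f1E// -f2E//.
  apply: (@measure_unique _ _ X G (fun=> setT) mG IG _ _ f1 f2) => //.
  - by rewrite -subTset => x _; exists 0%N.
  - move=> C GC; transitivity (m C B)%:E; first by apply: f1E; exact: mGA.
    by rewrite mpi//; apply/esym/f2E; exact: mGA.
  - by move=> _; rewrite ltey_eq fin_num_measure.
have {}mpi A B : measurable A -> measurable B -> m A B = fine (pi (A `*` B)).
  move=> mA mB; apply/EFin_inj.
  have [f1 f1E] := bimeasure_measure_r bm mA.
  have [f2 f2E] := bimeasure_measure_r bpi mA.
  rewrite -f1E// -f2E//.
  apply: (@measure_unique _ _ Y H (fun=> setT) mH IH _ _ f1 f2) => //.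
  - by rewrite -subTset => x _; exists 0%N.
  - move=> C HC; transitivity (m A C)%:E; first by apply: f1E; exact: mHB.
    by rewrite mpi//; apply/esym/f2E; exact: mHB.
  - by move=> _; rewrite ltey_eq fin_num_measure.
by move=> A B mA mB; rewrite -mpi//; exact: mP.
Qed.

End couplings.

(** * Lower semicontinuity of the distortion *)

Section lower_semicontinuity.
Context d1 d2 (S : measurableType d1) (S' : measurableType d2) (R : realType).
Context (Z : metricType R) (D : nat -> Z).
Hypothesis Ddense : dense_seq D.
Variables (a : S -> Z) (b : S' -> Z).
Hypotheses (ma : borel_measurable a) (mb : borel_measurable b).

Let dist (u : S * S') : R := mdist (a u.1) (b u.2).

Let mdistab : measurable_fun setT dist.
Proof.
apply: (measurable_mdist Ddense (a := a \o fst) (b := b \o snd)).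
  by apply: borel_measurable_comp => //; exact: measurable_fst.
by apply: borel_measurable_comp => //; exact: measurable_snd.
Qed.

Section cells.
Variable e : R.
Hypothesis e_gt0 : (0 < e)%R.

(** Cells partition Z into countably many sets of diameter at most 2 * e. *)
Let cell (z : Z) : nat := least_nat (fun n => (mdist z (D n) < e)%R).

Let cell_near z : (mdist z (D (cell z)) < e)%R.
Proof. by apply: (least_natP (Q := fun n => (mdist z (D n) < e)%R)); exact: Ddense. Qed.

Let measurable_cell d (T : measurableType d) (f : T -> Z) n :
  borel_measurable f -> measurable [set u | cell (f u) = n].
Proof.
move=> mf.
apply: (measurable_least_nat (Q := fun n u => (mdist (f u) (D n) < e)%R)) => j.
apply: measurable_lt_cst; apply: (measurable_mdist Ddense) => //.
exact: borel_measurable_cst.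
Qed.

(** The distance between two cells up to 4 * e, rounded down so as to stay below
    the distance between any two of their points. *)
Let weight (ij : nat * nat) : R := Num.max 0%R (mdist (D ij.1) (D ij.2) - 2 * e)%R.

Let index (u : S * S') : nat * nat := (cell (a u.1), cell (b u.2)).

Let approx (u : S * S') : R := weight (index u).

Let approx_ge0 u : (0 <= approx u)%R.
Proof. by rewrite /approx /weight le_max lexx. Qed.

Let approx_le u : (approx u <= dist u)%R.
Proof.
rewrite /approx /weight ge_max mdist_ge0 /=.
have := mdist_dist (D (cell (a u.1))) (a u.1) (D (cell (b u.2))) (b u.2).
have := cell_near (a u.1); have := cell_near (b u.2).
rewrite (metric_sym (D _) (a _)) (metric_sym (D _) (b _)) ler_norml.
by move=> ? ? /andP[_ ?]; rewrite /dist /index /=; lra.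
Qed.

Let dist_le u : (dist u <= approx u + 4 * e)%R.
Proof.
have : (mdist (D (cell (a u.1))) (D (cell (b u.2))) - 2 * e <= approx u)%R.
  by rewrite /approx /weight le_max lexx orbT.
have := mdist_dist (D (cell (a u.1))) (a u.1) (D (cell (b u.2))) (b u.2).
have := cell_near (a u.1); have := cell_near (b u.2).
rewrite (metric_sym (D _) (a _)) (metric_sym (D _) (b _)) ler_norml.
by move=> ? ? /andP[? _]; rewrite /dist; lra.
Qed.

Let part (ij : nat * nat) : set (S * S') :=
  [set s | cell (a s) = ij.1] `*` [set s | cell (b s) = ij.2].

Let measurable_part ij : measurable (part ij).
Proof. by apply: measurableX; exact: measurable_cell. Qed.

Let partP u ij : part ij u <-> index u = ij.
Proof. by case: ij => i j; split => [[/= <- <-]|[<- <-]]. Qed.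

Let measurable_approx : measurable_fun setT approx.
Proof.
move=> _ A mA; rewrite setTI (_ : _ @^-1` _ = [set u | exists ij : nat * nat,
    index u = ij /\ A (weight ij)]); last first.
  by apply/seteqP; split => u /=; [exists (index u) | move=> [ij [<-]]].
apply: measurable_exists => ij; apply: measurable_conj; last exact: measurable_prop.
rewrite (_ : [set u | _] = part ij); first exact: measurable_part.
by apply/seteqP; split => u /partP.
Qed.

Let term (f : R -> R) (n : nat) : R :=
  if pickle_inv n is Some ij then f (weight ij) else 0%R.

Let piece (n : nat) : set (S * S') :=
  if pickle_inv n is Some ij then part ij else set0.

Let measurable_piece n : measurable (piece n).
Proof. by rewrite /piece; case: pickle_inv. Qed.

Let integral_approx (f : R -> R) (P : probability (S * S')%type R) :
  (forall x, (0 <= f x)%R) -> measurable_fun setT f ->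
  \int[P]_u (f (approx u))%:E = \sum_(n <oo) ((term f n)%:E * P (piece n)).
Proof.
move=> f0 mf; have UT : \bigcup_n piece n = setT.
  rewrite -subTset => u _; exists (pickle (index u)) => //.
  by rewrite /piece pickleK_inv; apply/partP.
rewrite -{1}UT ge0_integral_bigcup//=.
- apply: eq_eseriesr => n _; rewrite /term /piece.
  case: (pickle_inv n) => [ij|]; last by rewrite integral_set0 mul0e.
  rewrite -integral_cst//; apply: eq_integral => u.
  by rewrite inE => /partP <-.
- apply/measurable_EFinP; rewrite UT.
  exact: measurableT_comp.
- by move=> u _; rewrite lee_fin.
- apply/trivIsetP => i j _ _ ij; rewrite /piece; apply/seteqP; split => // u [].
  case ui : (pickle_inv i) => [ij1|//]; case uj : (pickle_inv j) => [ij2|//].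
  move=> /partP u1 /partP u2; move: ui uj; rewrite -u1 -u2 => ui uj.
  move/eqP: ij; apply; move: ui uj.
  have h k : pickle_inv k = Some (index u) -> k = pickle (index u).
    by move=> kE; have := pickle_invK (T := (nat * nat)%type) k; rewrite kE.
  by move=> /h -> /h ->.
Qed.
Variables (U : set_system nat) (k : nat -> probability (S * S')%type R).
Variable pi : probability (S * S')%type R.
Hypothesis UU : UltraFilter U.
Hypothesis kpi : forall A B, measurable A -> measurable B ->
  fine (k n (A `*` B)) @[n --> U] --> fine (pi (A `*` B)).

Let piece_cvg i : fine (k n (piece i)) @[n --> U] --> fine (pi (piece i)).
Proof.
have PU : ProperFilter U by exact: ultra_proper.
rewrite /piece; case: pickle_inv => [ij|]; first by apply: kpi; exact: measurable_cell.
rewrite measure0 (_ : (fun n => _) = cst 0%R); first exact: cvg_cst.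
by apply/funext => n; rewrite measure0.
Qed.

Let Lnorm_approx_ultralimit (p : \bar R) (K : R) : 1 <= p -> (0 <= K)%R ->
  (\forall n \near U, Lnorm (k n) p (EFin \o dist) <= K%:E) ->
  Lnorm pi p (EFin \o approx) <= K%:E.
Proof.
have PU : ProperFilter U by exact: ultra_proper.
move=> p1 K0 kK.
have {}kK : \forall n \near U, Lnorm (k n) p (EFin \o approx) <= K%:E.
  apply: filterS kK => n; apply: le_trans; apply: le_Lnorm => //.
  by apply: nearW => u; rewrite !ger0_norm ?mdist_ge0// approx_le.
case: p p1 kK => [r||//] p1 kK.
  have r0 : (0 < r)%R by rewrite (lt_le_trans ltr01).
  have f0 (x : R) : (0 <= `|x| `^ r)%R by exact: powR_ge0.
  have mf : measurable_fun setT (fun x : R => `|x| `^ r)%R.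
    exact: (@measurableT_comp _ _ _ _ _ _ (@powR R ^~ r)).
  pose t := term (fun x : R => `|x| `^ r)%R.
  have t0 i : (0 <= t i)%R by rewrite /t /term; case: pickle_inv.
  have tP0 (P : probability (S * S')%type R) i : 0 <= (t i)%:E * P (piece i).
    by rewrite mule_ge0// lee_fin.
  rewrite Lnorm_fin_le// (integral_approx pi f0 mf).
  apply: lime_le; first exact: is_cvg_nneseries.
  apply: nearW => N.
  have sumE (P : probability (S * S')%type R) :
      (\sum_(0 <= i < N) (t i)%:E * P (piece i)) =
      (\sum_(0 <= i < N) t i * fine (P (piece i)))%R%:E.
    rewrite -sumEFin; apply: eq_bigr => i _.
    by rewrite EFinM fineK// fin_num_measure.
  rewrite [leLHS]sumE lee_fin.
  have sum_cvg : (\sum_(0 <= i < N) t i * fine (k n (piece i)))%R @[n --> U] -->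
      (\sum_(0 <= i < N) t i * fine (pi (piece i)))%R.
    elim: N {sumE} => [|N IH].
      by under eq_fun do rewrite big_nil; rewrite big_nil; exact: cvg_cst.
    under eq_fun do rewrite big_nat_recr//=; rewrite big_nat_recr//=.
    by apply: cvgD => //; apply: cvgM; [exact: cvg_cst | exact: piece_cvg].
  apply: (cvgr_to_le sum_cvg).
  apply: filterS kK => n; rewrite Lnorm_fin_le// (integral_approx (k n) f0 mf).
  rewrite -lee_fin -sumE; apply: le_trans.
  exact: nneseries_lim_ge.
rewrite Lnorm_oo; apply/ess_supP.
have null i : (K < term id i)%R -> pi (piece i) = 0.
  move=> Kt; rewrite -[LHS]fineK ?fin_num_measure//; congr EFin.
  apply: (ultra_cvg_unique UU (piece_cvg (i := i))).
  apply: (@cvg_trans _ (cst 0%R @ U)); last exact: cvg_cst.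
  apply: near_eq_cvg; apply: filterS kK => n.
  rewrite Lnorm_oo => /ess_supP[N [mN N0 subN]].
  rewrite (@subset_measure0 _ _ _ (k n) _ N)//.
  move=> u iu; apply: subN => /=; apply/negP; rewrite -ltNge lte_fin ger0_norm//.
  move: Kt iu; rewrite /term /piece; case: pickle_inv => [ij|//] Kt.
  by move=> /partP iu; rewrite /approx iu.
have : {ae pi, forall u, forall i, (K < term id i)%R -> ~ piece i u}.
  apply: ae_foralln => i; have [Kt|] := pselect (K < term id i)%R; last first.
    by move=> nKt; apply: nearW.
  exists (piece i); split => //; first exact: null.
  by move=> u /=; apply: contra_notP => npu _.
apply: filterS => u uP; rewrite lee_fin ger0_norm// leNgt; apply/negP => Ku.
apply: (uP (pickle (index u))); first by rewrite /term pickleK_inv.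
by rewrite /piece pickleK_inv; apply/partP.
Qed.

Lemma Lnorm_ultralimit_approx (p : \bar R) (K : R) : 1 <= p -> (0 <= K)%R ->
  (\forall n \near U, Lnorm (k n) p (EFin \o dist) <= K%:E) ->
  Lnorm pi p (EFin \o dist) <= (K + 4 * e)%:E.
Proof.
move=> p1 K0 kK; have e4 : (0 <= 4 * e)%R by rewrite mulr_ge0// ltW.
rewrite EFinD -[X in _ + X](_ : Lnorm pi p (EFin \o cst (4 * e)%R) = _); last first.
  by rewrite Lnorm_cst// ger0_norm.
apply: (le_trans (Lnorm_triangle (g := approx) (h := cst (4 * e)%R) p1 _ _ _ _)) => //.
  apply: nearW => u; rewrite !ger0_norm ?mdist_ge0//; exact: dist_le.
by apply: leeD2r; exact: Lnorm_approx_ultralimit.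
Qed.

End cells.

(** Decompose the metric space into countably many cells of small diameter. On
    the corresponding rectangles the measures converge, so the distance rounded
    to the cells has lower semicontinuous norm; the rounding error is uniform. *)
Lemma Lnorm_ultralimit (U : set_system nat)
    (k : nat -> probability (S * S')%type R) (pi : probability (S * S')%type R)
    (p : \bar R) (K : R) : UltraFilter U ->
  (forall A B, measurable A -> measurable B ->
    fine (k n (A `*` B)) @[n --> U] --> fine (pi (A `*` B))) ->
  1 <= p -> (0 <= K)%R ->
  (\forall n \near U, Lnorm (k n) p (EFin \o dist) <= K%:E) ->
  Lnorm pi p (EFin \o dist) <= K%:E.
Proof.
move=> UU kpi p1 K0 kK; apply/lee_addgt0Pr => e e0.
have e40 : (0 < e / 4)%R by rewrite divr_gt0.
have := Lnorm_ultralimit_approx e40 UU kpi p1 K0 kK.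
by rewrite mulrCA divff// mulr1 EFinD.
Qed.

End lower_semicontinuity.

(** * Optimal couplings *)

(** Enough to compare the two sides on rectangles. *)
Lemma is_pushforward_prod d1 d2 d3 d4 (T1 : measurableType d1)
    (T2 : measurableType d2) (S1 : measurableType d3) (S2 : measurableType d4)
    (R : realType) (P1 : probability T1 R) (P2 : probability T2 R)
    (Q1 : probability S1 R) (Q2 : probability S2 R) (f : T1 -> S1) (g : T2 -> S2) :
  measurable_fun setT f -> measurable_fun setT g ->
  is_pushforward f P1 Q1 -> is_pushforward g P2 Q2 ->
  is_pushforward (fun u => (f u.1, g u.2)) (P1 \x P2) (Q1 \x Q2).
Proof.
move=> mf mg PQ1 PQ2.
have mfg : measurable_fun setT (fun u : T1 * T2 => (f u.1, g u.2)).
  apply: measurable_fun_pair.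
    exact: measurableT_comp mf measurable_fst.
  exact: measurableT_comp mg measurable_snd.
have [m mE] := image_measure (P1 \x P2) mfg.
move=> A mA; rewrite /pushforward; apply/esym.
transitivity (m A); last exact: mE.
apply: (product_measure_unique (m' := m)) => // B C mB mC.
rewrite mE (_ : _ @^-1` _ = (f @^-1` B) `*` (g @^-1` C)); last first.
  by apply/seteqP; split => u [].
transitivity (P1 (f @^-1` B) * P2 (g @^-1` C)); last first.
  exact: (f_equal2 _ (PQ1 _ mB) (PQ2 _ mC)).
apply: product_measure1E.
- exact: (measurable_preimage mf).
- exact: (measurable_preimage mg).
Qed.

Lemma product_coupling d1 d2 (X : measurableType d1) (Y : measurableType d2)
    (R : realType) (mu : probability X R) (nu : probability Y R) :
  is_coupling mu nu (mu \x nu).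
Proof.
split => A mA; rewrite /pushforward.
  rewrite (_ : _ @^-1` _ = A `*` setT); last first.
    by apply/seteqP; split => -[x y] // [].
  transitivity (mu A * nu setT); first exact: product_measure1E.
  by rewrite probability_setT mule1.
rewrite (_ : _ @^-1` _ = setT `*` A); last first.
  by apply/seteqP; split => -[x y] // [].
transitivity (mu setT * nu A); first exact: product_measure1E.
by rewrite probability_setT mul1e.
Qed.

Section optimal_coupling.
Context d1 d2 (X : measurableType d1) (Y : measurableType d2) (R : realType).
Context (mu : probability X R) (nu : probability Y R).
Context (Z : metricType R) (D : nat -> Z).
Hypothesis Ddense : dense_seq D.
Variables (a : X * X -> Z) (b : Y * Y -> Z).
Hypotheses (ma : borel_measurable a) (mb : borel_measurable b).
Variable p : \bar R.
Hypothesis p_ge1 : 1 <= p.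

Definition distortion (pi : probability (X * Y)%type R) : \bar R :=
  Lnorm (pi \x pi) p
    (fun u => (mdist (a (u.1.1, u.2.1)) (b (u.1.2, u.2.2)))%:E).

(** It turns the square of a coupling of mu and nu into a coupling of their
    squares. *)
Let shuffle (u : (X * Y) * (X * Y)) : (X * X) * (Y * Y) :=
  ((u.1.1, u.2.1), (u.1.2, u.2.2)).

Let measurable_shuffle : measurable_fun setT shuffle.
Proof.
apply: measurable_fun_pair; apply: measurable_fun_pair.
- exact: measurableT_comp measurable_fst measurable_fst.
- exact: measurableT_comp measurable_fst measurable_snd.
- exact: measurableT_comp measurable_snd measurable_fst.
- exact: measurableT_comp measurable_snd measurable_snd.
Qed.

Let square (pi : probability (X * Y)%type R) :
  {k : probability ((X * X) * (Y * Y))%type R |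
    is_pushforward shuffle (pi \x pi) k}.
Proof.
apply/cid; have [k kE] := image_probability (pi \x pi) measurable_shuffle.
by exists k => A mA; rewrite kE.
Qed.

Let sq (pi : probability (X * Y)%type R) := sval (square pi).

Let sqP (pi : probability (X * Y)%type R) :
  is_pushforward shuffle (pi \x pi) (sq pi) := svalP (square pi).

Let sq_coupling (pi : probability (X * Y)%type R) : is_coupling mu nu pi ->
  is_coupling (mu \x mu) (nu \x nu) (sq pi).
Proof.
move=> [pi1 pi2]; split => A mA; rewrite /pushforward.
  have h := is_pushforward_prod measurable_fst measurable_fst pi1 pi1.
  rewrite -h// -sqP//.
  exact: (measurable_preimage measurable_fst).
have h := is_pushforward_prod measurable_snd measurable_snd pi2 pi2.
rewrite -h// -sqP//.
exact: (measurable_preimage measurable_snd).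
Qed.

Let sq_rect (pi : probability (X * Y)%type R) A A' B B' :
  measurable A -> measurable A' -> measurable B ->
  measurable B' -> fine (sq pi ((A `*` A') `*` (B `*` B'))) =
    (fine (pi (A `*` B)) * fine (pi (A' `*` B')))%R.
Proof.
move=> mA mA' mB mB'; rewrite -sqP; last first.
  by apply: measurableX; exact: measurableX.
rewrite /pushforward (_ : _ @^-1` _ = (A `*` B) `*` (A' `*` B')); last first.
  by apply/seteqP; split => -[[x y] [x' y']] /=; tauto.
have mAB : measurable (A `*` B) by exact: measurableX.
have mAB' : measurable (A' `*` B') by exact: measurableX.
transitivity (fine (pi (A `*` B) * pi (A' `*` B'))).
  exact: (congr1 fine (product_measure1E pi pi mAB mAB')).
by rewrite fineM// fin_num_measure.
Qed.

Let sq_distortion (pi : probability (X * Y)%type R) : Lnorm (sq pi) p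
  (EFin \o (fun u => mdist (a u.1) (b u.2))) = distortion pi.
Proof.
have mab : measurable_fun setT
    (fun u : (X * X) * (Y * Y) => mdist (a u.1) (b u.2)).
  apply: (measurable_mdist Ddense (a := a \o fst) (b := b \o snd)).
    by apply: borel_measurable_comp => //; exact: measurable_fst.
  by apply: borel_measurable_comp => //; exact: measurable_snd.
exact: (Lnorm_pushforward p_ge1 measurable_shuffle (sqP pi) mab).
Qed.

Let rectangles d (T : measurableType d) :=
  [set A `*` B | A in @measurable d T & B in @measurable d T].

Let rectangles_setI d (T : measurableType d) : setI_closed (@rectangles d T).
Proof.
move=> _ _ [A mA [B mB <-]] [A' mA' [B' mB' <-]].
exists (A `&` A'); first exact: measurableI.
by exists (B `&` B'); [exact: measurableI | rewrite setXI].
Qed.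

Let rectanglesT d (T : measurableType d) : @rectangles d T setT.
Proof. by exists setT => //; exists setT => //; rewrite setXTT. Qed.

(** The ultralimit of a minimising sequence. *)
Lemma optimal_coupling : codable Y -> exists pi, is_coupling mu nu pi /\
  forall pi', is_coupling mu nu pi' -> distortion pi <= distortion pi'.
Proof.
move=> cY.
have prod_coupling := product_coupling mu nu.
pose I := ereal_inf [set distortion pi | pi in is_coupling mu nu].
have I_le pi : is_coupling mu nu pi -> I <= distortion pi.
  by move=> cpi; apply: ereal_inf_lbound; exists pi.
have I0 : 0 <= I by apply/ereal_infP => _ [pi _ <-]; exact: Lnorm_ge0.
have [Ioo|Ioo] := eqVneq I +oo.
  exists (mu \x nu); split => // pi' /I_le; rewrite Ioo leye_eq => /eqP ->.
  exact: leey.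
have Ifin : I \is a fin_num by rewrite ge0_fin_numE// lt_neqAle Ioo leey.
have /choice[k kP] (n : nat) : exists pi, is_coupling mu nu pi /\
    distortion pi <= (fine I + n.+1%:R^-1)%:E.
  have n0 : (0 < n.+1%:R^-1 :> R)%R by rewrite invr_gt0 ltr0n.
  have [_ [pi cpi <-] lt] := lb_ereal_inf_adherent n0 Ifin.
  by exists pi; split => //; rewrite EFinD fineK// ltW.
have [U [UU Uoo]] := ultraFilterLemma (eventually_filter : ProperFilter \oo).
have PU : ProperFilter U by exact: ultra_proper.
have [pi [cpi kpi]] := coupling_ultralimit UU (fun n => (kP n).1) cY.
exists pi; split => // pi' cpi'; apply: (@le_trans _ _ I); last exact: I_le.
rewrite -(fineK Ifin); apply/lee_addgt0Pr => e e0; rewrite -EFinD -sq_distortion.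
apply: (Lnorm_ultralimit Ddense ma mb (k := fun n => sq (k n)) UU) => //.
- have ksq n : is_coupling (mu \x mu) (nu \x nu) (sq (k n)).
    by apply: sq_coupling; case: (kP n).
  apply: (@coupling_cvg_ext _ _ _ _ _ _ _ _ _ UU ksq (sq pi)
    (@rectangles _ X) (@rectangles _ Y)) => //.
  + exact: sq_coupling.
  + exact: measurable_prod_measurableType.
  + exact: rectangles_setI.
  + exact: measurable_prod_measurableType.
  + exact: rectangles_setI.
  + move=> _ _ [A mA [A' mA' <-]] [B mB [B' mB' <-]].
    rewrite sq_rect//; under eq_fun do rewrite sq_rect//.
    by apply: cvgM; exact: kpi.
- by rewrite addr_ge0 ?fine_ge0// ltW.
- apply: Uoo; have [N Ne] := invS_lt e0; exists N => // n /= Nn.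
  rewrite sq_distortion (le_trans (kP n).2)// lee_fin lerD2l.
  rewrite (le_trans _ (ltW Ne))// lef_pV2 ?posrE ?ltr0n//.
  by rewrite ler_nat ltnS.
Qed.

End optimal_coupling.

(** * The Gromov-Wasserstein pseudometric *)

Lemma probability_rect_ext d1 d2 (X : measurableType d1) (Y : measurableType d2)
    (R : realType) (P Q : probability (X * Y)%type R) :
  (forall A B, measurable A -> measurable B -> P (A `*` B) = Q (A `*` B)) ->
  forall E, measurable E -> P E = Q E.
Proof.
move=> PQ E mE.
apply: (@measure_unique _ _ (X * Y)%type
  [set A `*` B | A in @measurable _ X & B in @measurable _ Y] (fun=> setT)
  _ _ _ _ P Q) => //.
- exact: measurable_prod_measurableType.
- move=> _ _ [A mA [B mB <-]] [A' mA' [B' mB' <-]].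
  exists (A `&` A'); first exact: measurableI.
  by exists (B `&` B'); [exact: measurableI | rewrite setXI].
- by move=> _; exists setT => //; exists setT => //; rewrite setXTT.
- by rewrite -subTset => x _; exists 0%N.
- by move=> _ [A mA [B mB <-]]; exact: PQ.
- by move=> _; rewrite ltey_eq fin_num_measure.
Qed.

Lemma Lnorm_square_pushforward d1 d2 (T : measurableType d1)
    (S : measurableType d2) (R : realType) (P : probability T R)
    (Q : probability S R) (f : T -> S) (p : \bar R) (F : S * S -> R) :
  1 <= p -> measurable_fun setT f -> is_pushforward f P Q ->
  measurable_fun setT F ->
  Lnorm (Q \x Q) p (EFin \o F) =
  Lnorm (P \x P) p (EFin \o (fun u => F (f u.1, f u.2))).
Proof.
move=> p1 mf PQ mF.
have mff : measurable_fun setT (fun u : T * T => (f u.1, f u.2)).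
  apply: measurable_fun_pair.
    exact: measurableT_comp mf measurable_fst.
  exact: measurableT_comp mf measurable_snd.
exact: (Lnorm_pushforward p1 mff (is_pushforward_prod mf mf PQ PQ) mF).
Qed.

Section gromov_wasserstein.
Context (R : realType) (Z : metricType R) (p : \bar R).
Hypothesis Zseparable : separable_space Z.
Hypothesis p_ge1 : 1 <= p.
Local Notation network := (network Z p).
Local Notation cr X := (borel (carrier X)).

Local Notation om X := (@omega R Z p X).

Lemma network_dense_seq (X : network) : exists D : nat -> Z, dense_seq D.
Proof. exact: separable_dense_seq Zseparable (om X point). Qed.

Lemma measurable_mdist_network (X : network) d (T : measurableType d)
    (a b : T -> Z) : borel_measurable a -> borel_measurable b ->
  measurable_fun setT (fun u => mdist (a u) (b u)).
Proof. by have [D Dd] := network_dense_seq X; exact: (measurable_mdist Dd). Qed.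

Lemma borel_measurable_omega (X : network) d (T : measurableType d)
    (f g : T -> cr X) : measurable_fun setT f -> measurable_fun setT g ->
  borel_measurable (fun u => om X (f u, g u)).
Proof.
move=> mf mg; apply: (borel_measurable_comp (f := om X)
  (g := fun u => (f u, g u))).
  exact: measurable_fun_pair.
exact: (@omega_measurable R Z p X).
Qed.

Let along (X : network) d (T : measurableType d) (f : T -> cr X) (u : T * T) :=
  om X (f u.1, f u.2).

Let measurable_along X d (T : measurableType d) (f : T -> cr X) :
  measurable_fun setT f -> borel_measurable (along f).
Proof.
move=> mf; apply: borel_measurable_omega.
  exact: measurableT_comp mf measurable_fst.
exact: measurableT_comp mf measurable_snd.
Qed.

Lemma GW_attained (X Y : network) : exists2 pi, coupling (X := X) (Y := Y) pi &
  GW X Y = 2^-1%:E * distortion (om X) (om Y) p pi.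
Proof.
have [D Dd] := network_dense_seq X.
have [pi [cpi pimin]] := optimal_coupling (nmeas X) (nmeas Y) Dd
  (@omega_measurable _ _ _ X) (@omega_measurable _ _ _ Y) p_ge1
  (codable_polish (carrier_polish Y)).
exists pi => //; congr (_ * _); apply/eqP; rewrite eq_le; apply/andP; split.
  by apply: ereal_inf_lbound; exists pi.
by apply/ereal_infP => _ [pi' cpi' <-]; exact: pimin.
Qed.

Lemma GW_ge0 (X Y : network) : 0 <= GW X Y.
Proof.
by have [pi _ ->] := GW_attained X Y; rewrite mule_ge0// ?Lnorm_ge0// lee_fin.
Qed.

Lemma distortion_along (X Y : network) d (T : measurableType d)
    (P : probability T R) (pi : probability (cr X * cr Y)%type R)
    (f : T -> cr X) (g : T -> cr Y) :
  measurable_fun setT f -> measurable_fun setT g ->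
  is_pushforward (fun x => (f x, g x)) P pi ->
  distortion (om X) (om Y) p pi = Lnorm (P \x P) p
    (EFin \o (fun u => mdist (om X (f u.1, f u.2)) (om Y (g u.1, g u.2)))).
Proof.
move=> mf mg Ppi.
have mfg : measurable_fun setT (fun x => (f x, g x)) by exact: measurable_fun_pair.
pose F (u : (cr X * cr Y) * (cr X * cr Y)) : R :=
  mdist (om X (u.1.1, u.2.1)) (om Y (u.1.2, u.2.2)).
have mF : measurable_fun setT F.
  apply: (measurable_mdist_network X); apply: borel_measurable_omega.
  - exact: measurableT_comp measurable_fst measurable_fst.
  - exact: measurableT_comp measurable_fst measurable_snd.
  - exact: measurableT_comp measurable_snd measurable_fst.
  - exact: measurableT_comp measurable_snd measurable_snd.
exact: (Lnorm_square_pushforward p_ge1 mfg Ppi mF).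
Qed.

(** The law of (f, g) is a coupling. *)
Lemma GW_le_maps (X Y : network) d (T : measurableType d) (P : probability T R)
    (f : T -> cr X) (g : T -> cr Y) :
  measurable_fun setT f -> measurable_fun setT g ->
  is_pushforward f P (nmeas X) -> is_pushforward g P (nmeas Y) ->
  GW X Y <= 2^-1%:E * Lnorm (P \x P) p
    (EFin \o (fun u => mdist (om X (f u.1, f u.2)) (om Y (g u.1, g u.2)))).
Proof.
move=> mf mg Pf Pg.
have mfg : measurable_fun setT (fun x => (f x, g x)) by exact: measurable_fun_pair.
have [pi piE] := image_probability P mfg.
rewrite -(distortion_along (pi := pi) mf mg)//.
apply: lee_wpmul2l; first by rewrite lee_fin.
apply: ereal_inf_lbound; exists pi => //.
by split => A mA; rewrite /pushforward piE; [exact: Pf | exact: Pg].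
Qed.

Lemma GW_sym (X Y : network) : GW X Y = GW Y X.
Proof.
suff le (V W : network) : GW V W <= GW W V by apply/eqP; rewrite eq_le !le.
have [pi [pi1 pi2] ->] := GW_attained W V.
apply: le_trans (GW_le_maps measurable_snd measurable_fst pi2 pi1) _.
apply: lee_wpmul2l; first by rewrite lee_fin.
rewrite (distortion_along (P := pi) (f := fst) (g := snd)).
- apply: le_Lnorm => //.
  + by apply: (measurable_mdist_network V); apply: measurable_along.
  + by apply: (measurable_mdist_network V); apply: measurable_along.
  + by apply: nearW => u; rewrite metric_sym.
- exact: measurable_fst.
- exact: measurable_snd.
- by move=> A mA; rewrite /pushforward; congr (pi _); apply/seteqP; split => -[].
Qed.

(** Optimal couplings of X, Y and of Y, V are glued along Y, the second one being
    realised as the law of (y, Q (y, u)) with independent uniform noise u. *)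
Lemma GW_triangle (X Y V : network) : GW X V <= GW X Y + GW Y V.
Proof.
have [pi1 [pi1X pi1Y] ->] := GW_attained X Y.
have [pi2 cpi2 ->] := GW_attained Y V; have [pi2Y pi2V] := cpi2.
have [Q [mQ QE]] := randomisation (bimeasure_coupling cpi2)
  (codable_polish (carrier_polish V)).
pose T := ((cr X * cr Y) * measurableTypeR R)%type.
pose P : probability T R := pi1 \x unif R.
pose f (x : T) : cr X := x.1.1; pose g (x : T) : cr Y := x.1.2.
pose h (x : T) : cr V := Q (x.1.2, x.2).
have mf : measurable_fun setT f by exact: measurableT_comp measurable_fst measurable_fst.
have mg : measurable_fun setT g by exact: measurableT_comp measurable_snd measurable_fst.
have mgu : measurable_fun setT (fun x : T => (x.1.2, x.2)).
  by apply: measurable_fun_pair => //; exact: measurable_snd.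
have mh : measurable_fun setT h by exact: measurableT_comp mQ mgu.
have Pfst : is_pushforward fst P pi1.
  move=> A mA; rewrite /pushforward (_ : _ @^-1` _ = A `*` setT).
    transitivity (pi1 A * unif R setT); first exact: product_measure1E.
    by rewrite probability_setT mule1.
  by apply/seteqP; split => -[x y] // [].
have Pgu : is_pushforward (fun x : T => (x.1.2, x.2)) P (nmeas Y \x unif R).
  apply: (is_pushforward_prod measurable_snd (g := id)) => //.
have Pgh : is_pushforward (fun x => (g x, h x)) P pi2.
  have mgh : measurable_fun setT (fun x => (g x, h x)) by exact: measurable_fun_pair.
  have [P' P'E] := image_probability P mgh.
  move=> A mA; rewrite /pushforward -P'E; apply: probability_rect_ext => //.
  move=> B C mB mC; rewrite P'E.
  have mBC : measurable [set y : cr Y * measurableTypeR R | B y.1 /\ C (Q y)].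
    apply: measurable_conj.
      exact: (measurable_preimage measurable_fst).
    exact: (measurable_preimage mQ).
  rewrite -[RHS]fineK ?fin_num_measure//; last exact: measurableX.
  by rewrite -(QE _ _ mB mC) -(Pgu _ mBC).
have PfX : is_pushforward f P (nmeas X).
  move=> A mA; transitivity (pi1 (fst @^-1` A)); last exact: pi1X.
  by apply: Pfst; exact: (measurable_preimage measurable_fst).
have PhV : is_pushforward h P (nmeas V).
  move=> A mA; transitivity (pi2 (snd @^-1` A)); last exact: pi2V.
  by apply: Pgh; exact: (measurable_preimage measurable_snd).
apply: le_trans (GW_le_maps mf mh PfX PhV) _.
rewrite (distortion_along (P := P) mf mg); last first.
  move=> A mA; transitivity (pushforward P fst A); last exact: Pfst.
  by congr (P _); apply/seteqP; split => -[[]].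
rewrite (distortion_along (P := P) mg mh)// -ge0_muleDr ?Lnorm_ge0//.
apply: lee_wpmul2l; first by rewrite lee_fin.
apply: Lnorm_triangle => //.
- by apply: (measurable_mdist_network V); exact: measurable_along.
- by apply: (measurable_mdist_network V); exact: measurable_along.
- by apply: (measurable_mdist_network V); exact: measurable_along.
- by apply: nearW => u; rewrite !ger0_norm ?mdist_ge0// metric_triangle.
Qed.

Lemma GW_weak_iso (X Y : network) : weak_iso X Y -> GW X Y = 0.
Proof.
move=> [W [f [g [mf mg Wf Wg ae]]]].
apply/eqP; rewrite eq_le GW_ge0 andbT.
apply: le_trans (GW_le_maps mf mg Wf Wg) _.
rewrite -[leRHS](mule0 2^-1%:E) ; apply: lee_wpmul2l; first by rewrite lee_fin.
have -> : 0 = Lnorm (nmeas W \x nmeas W) p (EFin \o cst (0 : R)%R).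
  by rewrite Lnorm_cst// normr0.
apply: le_Lnorm => //.
  by apply: (measurable_mdist_network W); exact: measurable_along.
by apply: filterS ae => u [<- <-]; rewrite mdistxx.
Qed.

Lemma GW_weak_iso_eq (X X' Y Y' : network) : weak_iso X X' -> weak_iso Y Y' ->
  GW X Y = GW X' Y'.
Proof.
move=> /GW_weak_iso XX' /GW_weak_iso YY'.
apply/eqP; rewrite eq_le; apply/andP; split.
  apply: le_trans (GW_triangle X X' Y) _; rewrite XX' add0e.
  by apply: le_trans (GW_triangle X' Y' Y) _; rewrite (GW_sym Y' Y) YY' adde0.
apply: le_trans (GW_triangle X' X Y') _; rewrite (GW_sym X' X) XX' add0e.
by apply: le_trans (GW_triangle X Y Y') _; rewrite YY' adde0.
Qed.

Lemma weak_iso_refl (X : network) : weak_iso X X.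
Proof.
exists X, id, id; split => //.
by apply: nearW => -[].
Qed.

(** Finiteness of the norm does not depend on the base point. *)
Lemma network_Lnorm_lty (X : network) (z : Z) :
  Lnorm (nmeas X \x nmeas X) p (fun u => (mdist (om X u) z)%:E) < +oo.
Proof.
have [z0 h] := omega_Lp X; apply: le_lt_trans (lte_add_pinfty h (ltry (mdist z0 z))).
rewrite -[X in _ + X%:E](ger0_norm (mdist_ge0 z0 z)).
rewrite -(Lnorm_cst (nmeas X \x nmeas X) _ p_ge1).
apply: (Lnorm_triangle (f := fun u => mdist (om X u) z)
  (g := fun u => mdist (om X u) z0) p_ge1) => //.
- apply: (measurable_mdist_network X); first exact: (@omega_measurable R Z p X).
  exact: borel_measurable_cst.
- apply: (measurable_mdist_network X); first exact: (@omega_measurable R Z p X).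
  exact: borel_measurable_cst.
- by apply: nearW => u; rewrite !ger0_norm ?mdist_ge0// metric_triangle.
Qed.

Lemma along_Lnorm_lty (X : network) d (T : measurableType d) (P : probability T R)
    (f : T -> cr X) (z : Z) : measurable_fun setT f ->
  is_pushforward f P (nmeas X) ->
  Lnorm (P \x P) p (EFin \o (fun u => mdist (along f u) z)) < +oo.
Proof.
move=> mf Pf; have := network_Lnorm_lty X z.
rewrite (Lnorm_square_pushforward (F := fun u => mdist (om X u) z) p_ge1 mf Pf)//.
apply: (measurable_mdist_network X); first exact: (@omega_measurable R Z p X).
exact: borel_measurable_cst.
Qed.

Lemma maps_Lnorm_lty (X Y : network) d (T : measurableType d)
    (P : probability T R) (f : T -> cr X) (g : T -> cr Y) :
  measurable_fun setT f -> measurable_fun setT g ->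
  is_pushforward f P (nmeas X) -> is_pushforward g P (nmeas Y) ->
  Lnorm (P \x P) p (EFin \o
    (fun u => mdist (om X (f u.1, f u.2)) (om Y (g u.1, g u.2)))) < +oo.
Proof.
move=> mf mg Pf Pg; pose z := om X point.
apply: le_lt_trans (lte_add_pinfty (along_Lnorm_lty z mf Pf)
  (along_Lnorm_lty z mg Pg)).
apply: Lnorm_triangle => //.
- by apply: (measurable_mdist_network X); exact: measurable_along.
- apply: (measurable_mdist_network X); first exact: measurable_along.
  exact: borel_measurable_cst.
- apply: (measurable_mdist_network X); first exact: measurable_along.
  exact: borel_measurable_cst.
- apply: nearW => u; rewrite !ger0_norm ?mdist_ge0//.
  by rewrite (metric_sym (along g u)) metric_triangle.
Qed.

Lemma GW_lty (X Y : network) : GW X Y < +oo.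
Proof.
have [pi [pi1 pi2] ->] := GW_attained X Y.
rewrite lte_mul_pinfty// ?lee_fin//.
exact: (maps_Lnorm_lty measurable_fst measurable_snd pi1 pi2).
Qed.

End gromov_wasserstein.

(** * Parametrisation by the unit interval *)

(** A probability on S is a coupling with a point mass, so its randomisation is a
    function of the noise alone. *)
Lemma uniform_parametrisation d (S : measurableType d) (R : realType)
    (pi : probability S R) : codable S ->
  exists2 psi : measurableTypeR R -> S, measurable_fun setT psi &
    is_pushforward psi (unif R) pi.
Proof.
move=> cS; pose delta : probability unit R := dirac tt.
pose prod : probability (unit * S)%type R := delta \x pi.
have [Q [mQ QE]] := randomisation (bimeasure_coupling (product_coupling delta pi)) cS.
exists (fun u => Q (tt, u)).
  by apply: (measurableT_comp mQ); exact: pair1_measurable.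
move=> A mA; rewrite /pushforward -[RHS]mul1e -(probability_setT delta).
transitivity (prod (setT `*` A)); last exact: product_measure1E.
rewrite -[RHS]fineK; last by apply: (fin_num_measure prod); exact: measurableX.
rewrite -QE// (_ : [set p | _] = setT `*` [set u | A (Q (tt, u))]); last first.
  by apply/seteqP; split => -[[] u] /= [].
have mQA : measurable [set u | A (Q (tt, u))].
  rewrite -[X in measurable X]setTI.
  by apply: (measurableT_comp mQ (pair1_measurable tt)).
rewrite -[LHS]mul1e -(probability_setT delta).
by apply/esym; exact: product_measure1E.
Qed.

Section real_line.
Variable R : realType.

Lemma complete_real : complete_space R^o.
Proof.
move=> F PF cF; have /cvg_ex[l Fl] : cvg F by exact: (@cauchy_cvg R F PF cF).
by exists l.
Qed.

Lemma separable_real : separable_space R^o.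
Proof.
exists [set x : R | exists q : rat, x = ratr q].
  rewrite (_ : [set _ | _] = range (@ratr R)); first
    exact: card_le_trans (card_image_le _ _) (countableP _).
  by apply/seteqP; split => x /= [q]; [move=> ->; exists q | move=> _ <-; exists q].
move=> O [x Ox] oO; have : nbhs (x : R^o) O by exact: open_nbhs_nbhs.
move=> /nbhs_ballP[e /= e0 xO].
have xe : (x < x + e)%R by rewrite ltrDl.
have [q] := rat_in_itvoo xe; rewrite in_itv /= => /andP[xq qe].
exists (ratr q); split; last by exists q.
apply: xO; rewrite /ball /= ltr_norml; apply/andP; split; lra.
Qed.

Lemma polish_real : polish R R.
Proof.
exists R^o, id, id; split.
- exact: complete_real.
- exact: separable_real.
- by [].
- by move=> x; exact: cvg_id.
- by move=> x; exact: cvg_id.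
Qed.

Let to_borel : measurableTypeR R -> borel R := id.
Let of_borel : borel R -> measurableTypeR R := id.

Lemma measurable_of_borel : measurable_fun setT of_borel.
Proof.
apply: (measurability _ (RGenOpens.measurableE R)).
move=> _ [_ [x [y ->]] <-]; rewrite setTI.
by apply: sub_sigma_algebra; exact: interval_open.
Qed.

Lemma borel_uniform_parametrisation d (S : measurableType d)
    (pi : probability S R) : codable S ->
  exists (rho : probability (borel R) R) (psi : borel R -> S),
    measurable_fun setT psi /\ is_pushforward psi rho pi.
Proof.
move=> cS; have [psi mpsi psiE] := uniform_parametrisation pi cS.
have mto : measurable_fun setT to_borel.
  apply: borel_measurable_fun; apply: borel_measurable_open => V oV.
  exact: open_measurable.
have [rho rhoE] := image_probability (unif R) mto.
exists rho, (psi \o of_borel); split.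
  exact: measurableT_comp mpsi measurable_of_borel.
by move=> A mA; rewrite /pushforward rhoE; exact: psiE.
Qed.

End real_line.

(** * Geodesics of networks *)

Section network_geodesic.
Context (R : realType) (Z : metricType R) (p : \bar R).
Hypothesis Zcomplete : complete_space Z.
Hypothesis Zseparable : separable_space Z.
Hypothesis p_ge1 : 1 <= p.
Hypothesis Zgeodesic : geodesic (fun z z' : Z => (mdist z z')%:E).
Variables X Y : network Z p.
Local Notation om X := (@omega R Z p X).
Local Notation cr X := (borel (carrier X)).

(** Up to null sets, k on the line with the law rho is the pull-back of the kernel
    of N along a measure-preserving map; N itself may have another carrier, which
    allows N 0 = X and N 1 = Y in [network_geodesic]. *)
Let represents (rho : probability (borel R) R) (k : borel R * borel R -> Z)
    (N : network Z p) :=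
  exists psi : borel R -> cr N, [/\ measurable_fun setT psi,
    is_pushforward psi rho (nmeas N) &
    {ae rho \x rho, forall u, om N (psi u.1, psi u.2) = k u}].

(** Both networks are parametrised by the line along an optimal coupling, and
    the kernels a and b so obtained are joined pointwise by geodesics of Z. *)
Lemma interpolating_kernels : exists (rho : probability (borel R) R)
    (h : R -> borel R * borel R -> Z) (a b : borel R * borel R -> Z),
  [/\ (forall t, borel_measurable (h t)),
      (borel_measurable a /\ borel_measurable b),
      (represents rho a X /\ represents rho b Y),
      GW X Y = 2^-1%:E *
        Lnorm (rho \x rho) p (EFin \o (fun u => mdist (a u) (b u))) &
      {ae rho \x rho, forall u, [/\ h 0%R u = a u, h 1%R u = b u &
        forall s t : R, (0 <= s <= 1)%R -> (0 <= t <= 1)%R ->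
          mdist (h s u) (h t u) = (`|t - s| * mdist (a u) (b u))%R]}].
Proof.
have [pi [pi1 pi2] GWE] := GW_attained Zseparable p_ge1 X Y.
have cXY : codable (cr X * cr Y)%type.
  by apply: codable_prod; apply: codable_polish; exact: carrier_polish.
have [rho [psi [mpsi rhopi]]] := borel_uniform_parametrisation pi cXY.
pose f := fst \o psi; pose g := snd \o psi.
have mf : measurable_fun setT f by exact: measurableT_comp measurable_fst mpsi.
have mg : measurable_fun setT g by exact: measurableT_comp measurable_snd mpsi.
have rhoX : is_pushforward f rho (nmeas X).
  move=> A mA; transitivity (pi (fst @^-1` A)); last exact: pi1.
  by apply: rhopi; exact: (measurable_preimage measurable_fst).
have rhoY : is_pushforward g rho (nmeas Y).
  move=> A mA; transitivity (pi (snd @^-1` A)); last exact: pi2.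
  by apply: rhopi; exact: (measurable_preimage measurable_snd).
pose a u := om X (f u.1, f u.2); pose b u := om Y (g u.1, g u.2).
have ma : borel_measurable a.
  apply: borel_measurable_omega.
    exact: measurableT_comp mf measurable_fst.
  exact: measurableT_comp mf measurable_snd.
have mb : borel_measurable b.
  apply: borel_measurable_omega.
    exact: measurableT_comp mg measurable_fst.
  exact: measurableT_comp mg measurable_snd.
have [D Dd] := network_dense_seq Zseparable X.
have [h [mh hP]] := geodesic_selection (rho \x rho) Dd Zcomplete Zgeodesic ma mb.
exists rho, h, a, b; split => //.
- by split; [exists f | exists g]; split => //; exact: nearW.
- rewrite GWE (distortion_along Zseparable p_ge1 (P := rho) mf mg)//.
  move=> A mA; rewrite -rhopi//.
  by congr (rho _); apply/seteqP; split => u; rewrite /f /g /=; case: (psi u).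
Qed.

Lemma network_geodesic : exists (N : R -> network Z p),
  [/\ N 0%R = X, N 1%R = Y & forall s t : R, (0 <= s <= 1)%R ->
    (0 <= t <= 1)%R -> GW (N s) (N t) = `|t - s|%:E * GW X Y].
Proof.
have [rho [h [a [b [mh [ma mb] [rX rY] GWE hP]]]]] := interpolating_kernels.
have i0 : (0 <= (0 : R) <= 1)%R by rewrite lexx ler01.
have i1 : (0 <= (1 : R) <= 1)%R by rewrite lexx ler01.
have mdistm (c d : borel R * borel R -> Z) : borel_measurable c ->
    borel_measurable d -> measurable_fun setT (fun u => mdist (c u) (d u)).
  exact: (measurable_mdist_network Zseparable X).
have mcst (z : Z) : borel_measurable (fun _ : borel R * borel R => z).
  exact: borel_measurable_cst.
have GW_fin : GW X Y \is a fin_num.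
  by rewrite ge0_fin_numE; [exact: GW_lty | exact: GW_ge0].
have abfin : Lnorm (rho \x rho) p (EFin \o (fun u => mdist (a u) (b u))) < +oo.
  have -> : Lnorm (rho \x rho) p (EFin \o (fun u => mdist (a u) (b u))) =
      2%:E * GW X Y by rewrite GWE muleA -EFinM divff// mul1e.
  by rewrite lte_mul_pinfty// ?lee_fin// GW_lty.
pose z := om X point.
have azfin : Lnorm (rho \x rho) p (EFin \o (fun u => mdist (a u) z)) < +oo.
  have [psi [mpsi rpsi ae]] := rX.
  apply: le_lt_trans (along_Lnorm_lty Zseparable p_ge1 z mpsi rpsi).
  apply: le_Lnorm => //; first exact: mdistm.
    apply: mdistm => //; apply: borel_measurable_omega.
      exact: measurableT_comp mpsi measurable_fst.
    exact: measurableT_comp mpsi measurable_snd.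
  by apply: filterS ae => u /= ->.
(* h t stays within the distance from a to b of a, so it is as integrable. *)
have htfin t : (0 <= t <= 1)%R -> exists z0,
    Lnorm (rho \x rho) p (fun u => (mdist (h t u) z0)%:E) < +oo.
  move=> t01; exists z; apply: le_lt_trans (lte_add_pinfty abfin azfin).
  apply: (Lnorm_triangle (f := fun u => mdist (h t u) z)) => //.
  - exact: mdistm.
  - exact: mdistm.
  - exact: mdistm.
  apply: filterS hP => u [h0 _ hst]; rewrite !ger0_norm ?mdist_ge0//.
  apply: le_trans (metric_triangle _ (a u) _) _; rewrite lerD2r -h0 hst//.
  have /andP[t0 t1] := t01.
  by rewrite sub0r normrN ger0_norm// h0 ler_piMl// mdist_ge0.
have /choice[N NP] (t : R) : exists M : network Z p, [/\ t = 0%R -> M = X,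
    t = 1%R -> M = Y & (0 <= t <= 1)%R -> represents rho (h t) M].
  have [->|t0] := eqVneq t 0%R.
    exists X; split => // [/esym/eqP|_]; first by rewrite oner_eq0.
    have [psi [mpsi rpsi ae]] := rX; exists psi; split => //.
    by apply: filterS2 ae hP => u -> [->].
  have [->|t1] := eqVneq t 1%R.
    exists Y; split => // [/eqP|_]; first by rewrite oner_eq0.
    have [psi [mpsi rpsi ae]] := rY; exists psi; split => //.
    by apply: filterS2 ae hP => u -> [_ ->].
  have [t01|nt01] := pselect (0 <= t <= 1)%R; last first.
    by exists X; split => // /eqP; rewrite ?(negbTE t0) ?(negbTE t1).
  exists (Network (@polish_real R) (mh t) (htfin t t01)).
  split; [by move/eqP; rewrite (negbTE t0)|by move/eqP; rewrite (negbTE t1)|].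
  by move=> _; exists id; split => //; apply: nearW => -[].
have N0 : N 0%R = X by case: (NP 0%R) => + _ _; exact.
have N1 : N 1%R = Y by case: (NP 1%R) => _ + _; exact.
exists N; split => //.
(* The coupling of N s and N t by their maps from the line. *)
have lip s t : (0 <= s <= 1)%R -> (0 <= t <= 1)%R ->
    GW (N s) (N t) <= `|t - s|%:E * GW X Y.
  move=> s01 t01; have [_ _ /(_ s01)[f [mf rf aef]]] := NP s.
  have [_ _ /(_ t01)[g [mg rg aeg]]] := NP t.
  apply: le_trans (GW_le_maps Zseparable p_ge1 mf mg rf rg) _.
  rewrite GWE muleCA; apply: lee_wpmul2l; first by rewrite lee_fin.
  rewrite -(Lnorm_scale _ p_ge1)//; last exact: mdistm.
  apply: le_Lnorm => //.
  - apply: mdistm; apply: borel_measurable_omega.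
    + exact: measurableT_comp mf measurable_fst.
    + exact: measurableT_comp mf measurable_snd.
    + exact: measurableT_comp mg measurable_fst.
    + exact: measurableT_comp mg measurable_snd.
  - by apply: measurable_funM => //; exact: mdistm.
  - apply: filterS3 aef aeg hP => u -> -> [_ _ hst].
    by rewrite hst// !ger0_norm ?mulr_ge0 ?mdist_ge0.
suff le s t : (0 <= s)%R -> (s <= t)%R -> (t <= 1)%R ->
    GW (N s) (N t) = `|t - s|%:E * GW X Y.
  move=> s t /andP[s0 s1] /andP[t0 t1].
  have [st|/ltW ts] := leP s t; first exact: le.
  by rewrite (GW_sym Zseparable p_ge1) distrC; exact: le.
move=> s0 st t1.
have s01 : (0 <= s <= 1)%R by rewrite s0 (le_trans st t1).
have t01 : (0 <= t <= 1)%R by rewrite (le_trans s0 st) t1.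
apply/eqP; rewrite eq_le lip//=.
have GWfin (M M' : network Z p) : GW M M' \is a fin_num.
  by rewrite ge0_fin_numE; [exact: GW_lty | exact: GW_ge0].
(* The three upper bounds add up to GW X Y, so none of them is strict. *)
have tri := le_trans (GW_triangle Zseparable p_ge1 X (N s) Y)
  (leeD2l _ (GW_triangle Zseparable p_ge1 (N s) (N t) Y)).
have l0 := lip 0%R s i0 s01; have l1 := lip t 1%R t01 i1.
rewrite N0 in l0; rewrite N1 in l1.
move: tri l0 l1; rewrite -(fineK (GWfin X Y)) -(fineK (GWfin X (N s))).
rewrite -(fineK (GWfin (N s) (N t))) -(fineK (GWfin (N t) Y)).
rewrite -!EFinD -!EFinM !lee_fin subr0 !ger0_norm ?subr_ge0//.
by move=> tri l0 l1; lra.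
Qed.

End network_geodesic.

Theorem theorem44 (R : realType) (Z : metricType R) (p : \bar R)
    (Zcomplete : complete_space Z) (Zseparable : separable_space Z)
    (p_ge1 : 1 <= p)
    (Zgeodesic : geodesic (fun z z' : Z => (mdist z z')%:E)) :
  geodesic (@GW_class R Z p).
Proof.
move=> C D.
have [N [N0 N1 NP]] := network_geodesic Zcomplete Zseparable p_ge1 Zgeodesic
  (class_repr C) (class_repr D).
have /choice[G GP] (t : R) : exists E : network_class Z p,
    [/\ t = 0%R -> E = C, t = 1%R -> E = D & weak_iso (N t) (class_repr E)].
  have [->|t0] := eqVneq t 0%R.
    exists C; split => // [/esym/eqP|]; first by rewrite oner_eq0.
    by rewrite N0; exact: weak_iso_refl.
  have [->|t1] := eqVneq t 1%R.
    exists D; split => // [/eqP|]; first by rewrite oner_eq0.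
    by rewrite N1; exact: weak_iso_refl.
  (* The representative of the class of N t is some network weakly isomorphic to
     N t, as the class, being that of the representative, contains it. *)
  pose E : network_class Z p := exist _ (weak_iso (N t)) (ex_intro _ (N t) erefl).
  exists E; split; [by move/eqP; rewrite (negbTE t0)|by move/eqP; rewrite (negbTE t1)|].
  have : sval E = weak_iso (class_repr E) := svalP (cid (svalP E)).
  by move=> /= ->; exact: weak_iso_refl.
exists G; split.
- by case: (GP 0%R) => + _ _; exact.
- by case: (GP 1%R) => _ + _; exact.
- move=> s t s01 t01; rewrite /GW_class -NP//; apply/esym.
  by apply: (GW_weak_iso_eq Zseparable p_ge1); [case: (GP s) | case: (GP t)].
Qed.
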